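(* Let $A$ be a finitely generated $n$-rigid group, let $S \subseteq A^m$ be a non-empty irreducible algebraic set, and let $G = \Gamma(S)$ be the coordinate group of $S$. Then $G$ is an $n$-rigid group and $0 \le r_i(G) - r_i(A) \le m$ for all $i = 1, \ldots, n$.
   Context: **Algebraic sets.** Let $A$ be a group, $X = \{x_1,\ldots,x_m\}$, $F(X)$ the free group on $X$, and $A[X] = A * F(X)$. For $s \in A[X]$ and $(a_1,\ldots,a_m)\in A^m$, $s(a_1,\ldots,a_m)\in A$ is obtained by replacing each $x_j$ by $a_j$. For $T \subseteq A[X]$ put $V_A(T) = \{a \in A^m \mid s(a) = 1 \text{ for all } s\in T\}$; such sets are the algebraic subsets of $A^m$. The Zariski topology on $A^m$ is the topology having the algebraic sets as a pre-basis (subbasis) of closed sets. A closed subset is irreducible if it is not a union of two closed proper subsets. For an algebraic set $Y\subseteq A^m$, $I(Y) = \{f\in A[X] \mid f(a)=1 \text{ for all } a \in Y\}$, a normal subgroup of $A[X]$, and $\Gamma(Y) = A[X]/I(Y)$ is the coordinate group of $Y$. If $Y \ne\emptyset$ then $A$ embeds canonically into $\Gamma(Y)$. **Rigid groups.** If $C$ is a normal subgroup of a group $G$ and $C'\le C$ is normal in $G$ with $C/C'$ abelian and $[C,C]\le C'$, then $C/C'$ is a right $\mathbb{Z}[G/C]$-module via conjugation. A right $R$-module $T$ has no torsion if $xr=0$ ($x\in T$, $r\in R$) implies $x=0$ or $r=0$. A principal series of $G$ is a series of normal subgroups of $G$, $G = G_1 > G_2 > \cdots > G_n > G_{n+1}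 = 1$, such that each factor $G_i/G_{i+1}$ is abelian and has no torsion as a right $\mathbb{Z}[G/G_i]$-module ($i=1,\ldots,n$). A group with a principal series is called rigid; the series is unique and $n$ is the solvability class of $G$. A rigid group of solvability class $n$ is called $n$-rigid. The ring $R_i(G)=\mathbb{Z}[G/G_i]$ is an Ore domain, and for a torsion-free right module over an Ore domain the rank is the cardinality of a maximal linearly independent set. Put $T_i(G)=G_i/G_{i+1}$ and $r_i(G) = \operatorname{rank}_{R_i(G)} T_i(G)$ for $i = 1,\ldots,n$. *)

(* Defs.v *)
From HB Require Import structures.
From mathcomp Require Import finmap monalg.
From mathcomp Require Import all_boot all_algebra generic_quotient.
From mathcomp Require Import boolp classical_sets functions cardinality.
From mathcomp Require Import topology_structure.

Set Implicit Arguments.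
Unset Strict Implicit.
Unset Printing Implicit Defensive.

Import GRing.Theory.

Local Open Scope classical_set_scope.
Local Open Scope quotient_scope.
Local Open Scope group_scope.

(* Subgroups are the boolean predicates in [groupClosed].  This loses nothing:
   classically every Prop-valued predicate is the reflection of a boolean one. *)

HB.mixin Record isConjClosed (G : groupType) (S : {pred G}) := {
  gpred_conj : forall x g : G, x \in S -> x ^ g \in S
}.

#[short(type="normalClosed")]
HB.structure Definition NormalClosed G :=
  {S of GroupClosed G S & isConjClosed G S}.

Definition mk_normal (G : groupType) (S : {pred G}) (S1 : 1 \in S)
    (SM : mulg_closed S) (SV : invg_closed S)
    (SJ : forall x g : G, x \in S -> x ^ g \in S) : normalClosed G :=
  HB.pack_for (normalClosed G) S
    (isMul1Closed.Build G S S1) (isMulClosed.Build G S SM)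
    (isInvClosed.Build G S SV) (isConjClosed.Build G S SJ).

Definition generated (G : groupType) (X : set G) : set G :=
  [set x | forall H : groupClosed G, (forall y, X y -> y \in H) -> x \in H].

Definition finitely_generated (G : groupType) : Prop :=
  exists s : seq G, generated [set` s] = [set: G].

Fixpoint derived (G : groupType) (k : nat) : set G :=
  if k is k'.+1 then
    generated [set [~ x, y] | x in @derived G k' & y in @derived G k']
  else [set: G].

Arguments derived : clear implicits.

Definition solvability_class (G : groupType) (n : nat) : Prop :=
  derived G n = [set 1] /\ forall k, (k < n)%N -> derived G k <> [set 1].

Section Subgroup.
Variables (G : groupType) (H : groupClosed G).

Definition subg : Type := {x : G | x \in H}.
HB.instance Definition _ := SubChoice.on subg.

Lemma subg_closed : group_closed (mem H).
Proof. by split; [exact: gpred1 | exact: gpredF]. Qed.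

HB.instance Definition _ :=
  SubChoice_isSubGroup.Build G (mem H) subg subg_closed.

End Subgroup.

Section Quotient.
Variables (G : groupType) (N : normalClosed G).

Definition eq_mod : rel G := fun x y => x^-1 * y \in N.

Lemma eq_mod_equiv : equiv_class_of eq_mod.
Proof.
split=> [x|x y|y x z]; rewrite /eq_mod; first by rewrite mulVg gpred1.
  by rewrite -gpredV invgM invgK.
by move=> xy yz; rewrite -(mulgK y x^-1) -mulgA gpredM.
Qed.

Canonical eq_mod_equivRel := EquivRelPack eq_mod_equiv.

Definition quotg : Type := {eq_quot eq_mod}.
HB.instance Definition _ := Choice.on quotg.
HB.instance Definition _ := EqQuotient.on quotg.

Lemma eq_modP x y : reflect (\pi_quotg x = \pi_quotg y) (x^-1 * y \in N).
Proof. exact: eqmodP. Qed.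

Definition quotg_one : quotg := \pi_quotg 1.
Definition quotg_mul (u v : quotg) : quotg := \pi_quotg (repr u * repr v).
Definition quotg_inv (u : quotg) : quotg := \pi_quotg (repr u)^-1.

Lemma repr_mod x : x^-1 * repr (\pi_quotg x) \in N.
Proof. by apply/eq_modP; rewrite reprK. Qed.

Lemma quotg_mulE x y : quotg_mul (\pi_quotg x) (\pi y) = \pi_quotg (x * y).
Proof.
apply/esym/eq_modP; set x' := repr _; set y' := repr _.
have -> : (x * y)^-1 * (x' * y') = (x^-1 * x') ^ y * (y^-1 * y').
  by rewrite conjgE invgM !mulgA mulgK.
by rewrite gpredM ?gpred_conj ?repr_mod.
Qed.

Lemma quotg_invE x : quotg_inv (\pi_quotg x) = \pi_quotg x^-1.
Proof.
apply/eq_modP; rewrite invgK; set x' := repr _.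
have -> : x' * x^-1 = (x^-1 * x') ^ x^-1.
  by rewrite conjgE invgK !mulgA mulgV mul1g.
by rewrite gpred_conj ?repr_mod.
Qed.

Lemma quotg_mulA : associative quotg_mul.
Proof.
elim/quotW=> x; elim/quotW=> y; elim/quotW=> z; 
by rewrite (quotg_mulE y z) (quotg_mulE x y) (quotg_mulE x) quotg_mulE mulgA.
Qed.

Lemma quotg_mul1 : left_id quotg_one quotg_mul.
Proof. by elim/quotW=> x; rewrite quotg_mulE mul1g. Qed.

Lemma quotg_1mul : right_id quotg_one quotg_mul.
Proof. by elim/quotW=> x; rewrite quotg_mulE mulg1. Qed.

Lemma quotg_mulV : left_inverse quotg_one quotg_inv quotg_mul.
Proof. by elim/quotW=> x; rewrite quotg_invE quotg_mulE mulVg. Qed.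

Lemma quotg_Vmul : right_inverse quotg_one quotg_inv quotg_mul.
Proof. by elim/quotW=> x; rewrite quotg_invE quotg_mulE mulgV. Qed.

HB.instance Definition _ :=
  isGroup.Build quotg quotg_mulA quotg_mul1 quotg_1mul quotg_mulV quotg_Vmul.

Lemma pi_quotg_morph : monoid.monoid_morphism (\pi_quotg : G -> quotg).
Proof. by split=> // x y; rewrite -quotg_mulE. Qed.
End Quotient.

(* Groups given by generators and relations, as words modulo the congruence
   generated by the relations; every letter comes with an inverse letter. *)

Inductive word_eq (L : Type) (R : seq L -> seq L -> Prop) :
    seq L -> seq L -> Prop :=
| WordRel p u v s of R u v : word_eq R (p ++ u ++ s) (p ++ v ++ s)
| WordRefl u : word_eq R u u
| WordSym u v of word_eq R u v : word_eq R v u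
| WordTrans u v w of word_eq R u v & word_eq R v w : word_eq R u w.

Record presentation := Presentation {
  letter : choiceType;
  relation : seq letter -> seq letter -> Prop;
  letter_inv : letter -> letter;
  letter_invr : forall l, word_eq relation [:: l; letter_inv l] [::];
  letter_invl : forall l, word_eq relation [:: letter_inv l; l] [::]
}.

Section PresentedGroup.
Variable P : presentation.
Local Notation word := (seq (letter P)).
Local Notation weq := (word_eq (@relation P)).

Definition weqb : rel word := fun u v => `[< weq u v >].

Lemma weqb_equiv : equiv_class_of weqb.
Proof.
split=> [u|u v|v u w]; first exact/asboolP/WordRefl.
  by apply/asboolP/asboolP; exact: WordSym.
by move=> /asboolP uv /asboolP vw; apply/asboolP/WordTrans; eauto.
Qed.

Canonical weqb_equivRel := EquivRelPack weqb_equiv.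

Definition pgroup : Type := {eq_quot weqb}.
HB.instance Definition _ := Choice.on pgroup.
HB.instance Definition _ := EqQuotient.on pgroup.

Lemma weqP u v : \pi_pgroup u = \pi_pgroup v <-> weq u v.
Proof. by split=> [/eqmodP/asboolP|uv]; last exact/eqmodP/asboolP. Qed.

Lemma weq_repr u : weq (repr (\pi_pgroup u)) u.
Proof. by apply/weqP; rewrite reprK. Qed.

Lemma weq_ctx p u v s : weq u v -> weq (p ++ u ++ s) (p ++ v ++ s).
Proof.
move=> uv; elim: uv p s => {u v} [p' u v s' Ruv|u|u v _ IH|u v w _ IHu _ IHv]
  p s.
- have := WordRel (p ++ p') (s' ++ s) Ruv.
  by rewrite -!catA.
- exact: WordRefl.
- exact/WordSym/IH.
- exact: WordTrans (IHu p s) (IHv p s).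
Qed.

Lemma weq_cat u u' v v' : weq u u' -> weq v v' -> weq (u ++ v) (u' ++ v').
Proof.
move=> /(weq_ctx [::] v) /= uu' /(weq_ctx u' [::]); rewrite !cats0.
exact: WordTrans.
Qed.

Definition word_inv (u : word) : word := rev (map (@letter_inv P) u).

Lemma word_inv_rel u : weq (word_inv u ++ u) [::] /\ weq (u ++ word_inv u) [::].
Proof.
elim: u => [|l u [IHl IHr]]; first by split; exact: WordRefl.
rewrite /word_inv /= rev_cons -/(word_inv u) -cats1; split.
  apply: WordTrans IHl; rewrite -catA /=.
  exact: (weq_ctx (word_inv u) u (letter_invl l)).
have /= := weq_ctx [:: l] [:: letter_inv l] IHr; rewrite -catA => h.
exact: WordTrans h (letter_invr l).
Qed.

Definition pg_one : pgroup := \pi_pgroup [::].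
Definition pg_mul (x y : pgroup) : pgroup := \pi_pgroup (repr x ++ repr y).
Definition pg_inv (x : pgroup) : pgroup := \pi_pgroup (word_inv (repr x)).

Lemma pg_mulE u v : pg_mul (\pi_pgroup u) (\pi_pgroup v) = \pi_pgroup (u ++ v).
Proof. by apply/weqP/weq_cat; exact: weq_repr. Qed.

Lemma pg_mulA : associative pg_mul.
Proof. elim/quotW=> u; elim/quotW=> v; elim/quotW=> w; 
by rewrite (pg_mulE v w) (pg_mulE u v) (pg_mulE u) pg_mulE catA. Qed.

Lemma pg_mul1 : left_id pg_one pg_mul.
Proof. by elim/quotW=> u; rewrite pg_mulE. Qed.

Lemma pg_1mul : right_id pg_one pg_mul.
Proof. by elim/quotW=> u; rewrite pg_mulE cats0. Qed.

Lemma pg_mulV : left_inverse pg_one pg_inv pg_mul.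
Proof.
move=> x; rewrite -[in X in pg_mul _ X](reprK x) pg_mulE.
by apply/weqP; have [] := word_inv_rel (repr x).
Qed.

Lemma pg_Vmul : right_inverse pg_one pg_inv pg_mul.
Proof.
move=> x; rewrite -[in X in pg_mul X _](reprK x) pg_mulE.
by apply/weqP; have [] := word_inv_rel (repr x).
Qed.

HB.instance Definition _ :=
  isGroup.Build pgroup pg_mulA pg_mul1 pg_1mul pg_mulV pg_Vmul.

Definition pg_gen (l : letter P) : pgroup := \pi_pgroup [:: l].

Section Lift.
Variables (H : groupType) (f : letter P -> H).

Definition pg_lift (x : pgroup) : H := \prod_(l <- repr x) f l.

Hypothesis fR : forall u v, relation u v ->
  \prod_(l <- u) f l = \prod_(l <- v) f l.

Lemma pg_liftE u : pg_lift (\pi_pgroup u) = \prod_(l <- u) f l.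
Proof.
suff weq_prod v w : weq v w -> \prod_(l <- v) f l = \prod_(l <- w) f l.
  exact/weq_prod/weq_repr.
elim=> // [p v' w' s /fR vw|v' w' t _ -> _ -> //].
by rewrite !big_cat /= vw.
Qed.

Lemma pg_lift_morph : monoid.monoid_morphism pg_lift.
Proof.
split=> [|x y]; first by rewrite pg_liftE big_nil.
by rewrite [x * y]/(pg_mul x y) pg_liftE big_cat.
Qed.

Lemma pg_lift_gen l : pg_lift (pg_gen l) = f l.
Proof. by rewrite pg_liftE big_seq1. Qed.
End Lift.
End PresentedGroup.

Section FreeGroup.
Variable X : choiceType.

(* The letter [(x, true)] stands for x and [(x, false)] for its inverse. *)
Inductive free_relation : seq (X * bool) -> seq (X * bool) -> Prop :=
| FreeCancel x b : free_relation [:: (x, b); (x, ~~ b)] [::].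

Definition free_inv (l : X * bool) : X * bool := (l.1, ~~ l.2).

Lemma free_invr l : word_eq free_relation [:: l; free_inv l] [::].
Proof. by case: l => x b; exact: (WordRel [::] [::] (FreeCancel x b)). Qed.

Lemma free_invl l : word_eq free_relation [:: free_inv l; l] [::].
Proof. by have := free_invr (free_inv l); case: l => x []. Qed.

Definition free_presentation := Presentation free_invr free_invl.
Definition free_group : Type := pgroup free_presentation.
HB.instance Definition _ := Group.on free_group.

Definition free_gen (x : X) : free_group := pg_gen ((x, true) : letter free_presentation).

Section Lift.
Variables (H : groupType) (f : X -> H).

Let letter_lift (l : X * bool) : H := if l.2 then f l.1 else (f l.1)^-1.

Definition free_lift : free_group -> H :=
  @pg_lift free_presentation H letter_lift.

Lemma free_lift_rel u v : relation (p := free_presentation) u v ->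
  \prod_(l <- u) letter_lift l = \prod_(l <- v) letter_lift l.
Proof.
by case=> x [] /=; rewrite !big_cons !big_nil /= mulg1 ?mulgV ?mulVg.
Qed.

HB.instance Definition _ :=
  isUMagmaMorphism.Build free_group H free_lift (pg_lift_morph free_lift_rel).

Lemma free_lift_gen x : free_lift (free_gen x) = f x.
Proof. exact: (pg_lift_gen free_lift_rel). Qed.
End Lift.
End FreeGroup.

Section FreeProduct.
Variables A B : groupType.

Inductive product_relation : seq (A + B) -> seq (A + B) -> Prop :=
| ProductMul1 a a' : product_relation [:: inl a; inl a'] [:: inl (a * a')]
| ProductMul2 b b' : product_relation [:: inr b; inr b'] [:: inr (b * b')]
| ProductOne1 : product_relation [:: inl 1] [::]
| ProductOne2 : product_relation [:: inr 1] [::].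

Definition product_inv (l : A + B) : A + B :=
  match l with inl a => inl a^-1 | inr b => inr b^-1 end.

Lemma product_invr l : word_eq product_relation [:: l; product_inv l] [::].
Proof.
have rel u v (uv : product_relation u v) : word_eq product_relation u v.
  by have := WordRel [::] [::] uv; rewrite !cats0.
case: l => [a|b] /=.
  by apply: WordTrans (rel _ _ (ProductMul1 _ _)) _; rewrite mulgV;
     apply: rel; constructor.
by apply: WordTrans (rel _ _ (ProductMul2 _ _)) _; rewrite mulgV;
   apply: rel; constructor.
Qed.

Lemma product_invl l : word_eq product_relation [:: product_inv l; l] [::].
Proof.
by have := product_invr (product_inv l); case: l => [a|b] /=; rewrite invgK.
Qed.

Definition product_presentation := Presentation product_invr product_invl.
Definition free_product : Type := pgroup product_presentation.
HB.instance Definition _ := Group.on free_product.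

Definition free_product_inl (a : A) : free_product :=
  pg_gen (inl a : letter product_presentation).
Definition free_product_inr (b : B) : free_product :=
  pg_gen (inr b : letter product_presentation).

Section Lift.
Variables (H : groupType) (f : UMagmaMorphism.type A H).
Variable (g : UMagmaMorphism.type B H).

Let letter_lift (l : A + B) : H := match l with inl a => f a | inr b => g b end.

Definition free_product_lift : free_product -> H :=
  @pg_lift product_presentation H letter_lift.

Lemma free_product_lift_rel u v :
  relation (p := product_presentation) u v ->
  \prod_(l <- u) letter_lift l = \prod_(l <- v) letter_lift l.
Proof.
by case=> [a a'|b b'||]; rewrite !big_cons !big_nil /= !mulg1 ?gmulfM ?gmulf1.
Qed.

HB.instance Definition _ := isUMagmaMorphism.Build free_product H
  free_product_lift (pg_lift_morph free_product_lift_rel).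

Lemma free_product_lift_inl a : free_product_lift (free_product_inl a) = f a.
Proof. exact: (pg_lift_gen free_product_lift_rel). Qed.

Lemma free_product_lift_inr b : free_product_lift (free_product_inr b) = g b.
Proof. exact: (pg_lift_gen free_product_lift_rel). Qed.
End Lift.
End FreeProduct.

Section AlgebraicGeometry.
Variables (A : groupType) (m : nat).

(* A[X] = A * F(X) with X = {x_1, ..., x_m} *)
Definition gpoly : Type := free_product A (free_group 'I_m).
HB.instance Definition _ := Group.on gpoly.

Definition gconst (c : A) : gpoly := free_product_inl _ c.
Definition gvar (j : 'I_m) : gpoly := free_product_inr _ (free_gen j).

Definition affine : Type := {ffun 'I_m -> A}.
HB.instance Definition _ := Choice.on affine.

Definition geval (a : affine) : gpoly -> A :=
  free_product_lift (idfun : UMagmaMorphism.type A A) (free_lift a).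
HB.instance Definition _ a := UMagmaMorphism.on (geval a).

Lemma geval1 a : geval a 1 = 1. Proof. exact: gmulf1. Qed.
Lemma gevalM a f g : geval a (f * g) = geval a f * geval a g.
Proof. exact: gmulfM. Qed.
Lemma gevalV a f : geval a f^-1 = (geval a f)^-1. Proof. exact: gmulfV. Qed.
Lemma geval_const a c : geval a (gconst c) = c.
Proof. exact: free_product_lift_inl. Qed.
Lemma geval_var a j : geval a (gvar j) = a j.
Proof.
by rewrite /geval free_product_lift_inr [LHS]free_lift_gen.
Qed.

Definition zero_locus (T : set gpoly) : set affine :=
  [set a | forall s, T s -> geval a s = 1].

Definition algebraic_set (Y : set affine) : Prop := exists T, Y = zero_locus T.

(* The Zariski topology: the complements of the algebraic sets form a subbasis
   of open sets. *)
HB.instance Definition _ := isSubBaseTopological.Build affine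
  (I := set gpoly) [set: set gpoly] (fun T => ~` zero_locus T).

Lemma closed_algebraic_set (Y : set affine) : algebraic_set Y -> closed Y.
Proof.
move=> [T ->]; rewrite -openC.
exists [set ~` zero_locus T]; last by rewrite bigcup_set1.
move=> _ ->; exists [fset T]%fset; first by move=> ? _; rewrite in_setT.
by rewrite set_fset1 bigcap_set1.
Qed.

Variable Y : set affine.

Definition vanishing : {pred gpoly} :=
  fun f => `[< forall a, Y a -> geval a f = 1 >].

Lemma vanishing1 : 1 \in vanishing.
Proof. by apply/asboolP => a _; rewrite geval1. Qed.

Lemma vanishingM : mulg_closed vanishing.
Proof.
move=> f g /asboolP f1 /asboolP g1; apply/asboolP => a Ya.
by rewrite gevalM f1 ?g1 ?mulg1.
Qed.

Lemma vanishingV : invg_closed vanishing.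
Proof.
by move=> f /asboolP f1; apply/asboolP => a Ya; rewrite gevalV f1 ?invg1.
Qed.

Lemma vanishingJ f g : f \in vanishing -> f ^ g \in vanishing.
Proof.
move=> /asboolP f1; apply/asboolP => a Ya.
by rewrite !gevalM f1 // mul1g -gevalM mulVg geval1.
Qed.

Definition vanishing_subgroup : normalClosed gpoly :=
  mk_normal vanishing1 vanishingM vanishingV vanishingJ.

Definition coordinate_group : Type := quotg vanishing_subgroup.
HB.instance Definition _ := Group.on coordinate_group.
End AlgebraicGeometry.

Definition irreducible_set (T : topologicalType) (S : set T) : Prop :=
  closed S /\
  ~ exists Y Z : set T, [/\ closed Y, closed Z, Y `<` S, Z `<` S & S = Y `|` Z].

(* The integral group ring: finitely supported functions Q -> int with the
   convolution product.  The product on [malg] itself is only available when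
   the exponents have no invertible element but 1. *)
Section GroupRing.
Variable Q : groupType.
Local Open Scope ring_scope.

Definition group_ring : Type := {malg int[Q]}.
HB.instance Definition _ := GRing.Zmodule.on group_ring.

Implicit Types r s t : {malg int[Q]}.

Definition gr_one : {malg int[Q]} := << 1 *g 1%g >>.
Definition gr_mul r s : {malg int[Q]} :=
  \sum_(p <- msupp r) \sum_(q <- msupp s) << r@_p * s@_q *g (p * q)%g >>.

Lemma gr_mulw (d e : {fset Q}) r s :
  (msupp r `<=` d)%fset -> (msupp s `<=` e)%fset ->
  gr_mul r s =
    \sum_(p <- d) \sum_(q <- e) << r@_p * s@_q *g (p * q)%g >>.
Proof.
move=> rd se; rewrite /gr_mul (big_fset_incl _ rd) /=.
  apply: eq_bigr => p _; apply: big_fset_incl => // q _ /mcoeff_outdom ->.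
  by rewrite mulr0 monalgU0.
move=> p _ /mcoeff_outdom rp.
by rewrite big1 // => q _; rewrite rp mul0r monalgU0.
Qed.

Lemma gr_mulDl : left_distributive gr_mul +%R.
Proof.
move=> r s t; set d := (msupp r `|` msupp s)%fset; set e := msupp t.
rewrite (@gr_mulw d e (r + s)) ?msuppD_le ?fsubset_refl//.
rewrite (@gr_mulw d e r) ?fsubsetUl ?fsubset_refl//.
rewrite (@gr_mulw d e s) ?fsubsetUr ?fsubset_refl//.
rewrite -big_split; apply: eq_bigr => p _ /=.
rewrite -big_split; apply: eq_bigr => q _ /=.
by rewrite mcoeffD mulrDl monalgUD.
Qed.

Lemma gr_mulDr : right_distributive gr_mul +%R.
Proof.
move=> t r s; set d := (msupp r `|` msupp s)%fset; set e := msupp t.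
rewrite (@gr_mulw e d _ (r + s)) ?msuppD_le ?fsubset_refl//.
rewrite (@gr_mulw e d _ r) ?fsubsetUl ?fsubset_refl//.
rewrite (@gr_mulw e d _ s) ?fsubsetUr ?fsubset_refl//.
rewrite -big_split; apply: eq_bigr => p _ /=.
rewrite -big_split; apply: eq_bigr => q _ /=.
by rewrite mcoeffD mulrDr monalgUD.
Qed.

Lemma gr_mul0r : left_zero 0 gr_mul.
Proof. by move=> r; rewrite /gr_mul msupp0 big_seq_fset0. Qed.

Lemma gr_mulr0 : right_zero 0 gr_mul.
Proof.
by move=> r; rewrite /gr_mul big1 // => p _; rewrite msupp0 big_seq_fset0.
Qed.

Lemma gr_mulUU (c d : int) (p q : Q) :
  gr_mul << c *g p >> << d *g q >> = << c * d *g (p * q)%g >>.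
Proof. by rewrite (gr_mulw msuppU_le msuppU_le) !big_seq_fset1 !mcoeffUU. Qed.

Lemma gr_suml I (e : seq I) (F : I -> {malg int[Q]}) s :
  gr_mul (\sum_(i <- e) F i) s = \sum_(i <- e) gr_mul (F i) s.
Proof.
exact: (big_morph (gr_mul^~ s) (fun _ _ => gr_mulDl _ _ _) (gr_mul0r _)).
Qed.

Lemma gr_sumr I (e : seq I) (F : I -> {malg int[Q]}) s :
  gr_mul s (\sum_(i <- e) F i) = \sum_(i <- e) gr_mul s (F i).
Proof.
exact: (big_morph (gr_mul s) (fun _ _ => gr_mulDr _ _ _) (gr_mulr0 _)).
Qed.

Lemma gr_mulA : associative gr_mul.
Proof.
move=> r s t; rewrite (monalgE r) !gr_suml; apply: eq_bigr => p _.
rewrite (monalgE s) gr_suml !gr_sumr gr_suml; apply: eq_bigr => q _.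
rewrite (monalgE t) !gr_sumr; apply: eq_bigr => o _.
by rewrite !gr_mulUU mulrA mulgA.
Qed.

Lemma gr_mul1r : left_id gr_one gr_mul.
Proof.
move=> r; rewrite [in RHS](monalgE r) {1}(monalgE r) gr_sumr.
by apply: eq_bigr => p _; rewrite gr_mulUU mul1r mul1g.
Qed.

Lemma gr_mulr1 : right_id gr_one gr_mul.
Proof.
move=> r; rewrite [in RHS](monalgE r) {1}(monalgE r) gr_suml.
by apply: eq_bigr => p _; rewrite gr_mulUU mulr1 mulg1.
Qed.

Lemma gr_one_neq0 : gr_one != 0.
Proof. by rewrite monalgU_eq0. Qed.

HB.instance Definition _ := GRing.Zmodule_isNzRing.Build group_ring
  gr_mulA gr_mul1r gr_mulr1 gr_mulDl gr_mulDr gr_one_neq0.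
End GroupRing.

(* A right R-module is a left module over the converse ring R^c: the element
   xr is written [(r : R^c) *: x]. *)
Section RightModule.
Variables (R : nzRingType) (T : lmodType R^c).
Local Open Scope ring_scope.

Definition no_torsion : Prop :=
  forall (x : T) (r : R), (r : R^c) *: x = 0 -> x = 0 \/ r = 0.

Definition lin_indep (B : set T) : Prop :=
  forall (s : seq T) (c : T -> R), uniq s -> [set` s] `<=` B ->
    \sum_(x <- s) (c x : R^c) *: x = 0 -> forall x, x \in s -> c x = 0.

Definition max_lin_indep (B : set T) : Prop :=
  lin_indep B /\ forall B', lin_indep B' -> B `<=` B' -> B' = B.

Definition has_rank (k : nat) : Prop :=
  exists2 B : set T, max_lin_indep B & (B #= `I_k)%card.
End RightModule.

(* C = [sec_top] and C' = [sec_bot] with [C, C] <= C' <= C, both normal in G *)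
Record abelian_section (G : groupType) := AbelianSection {
  sec_top : normalClosed G;
  sec_bot : normalClosed G;
  sec_sub : forall x, x \in sec_bot -> x \in sec_top;
  sec_comm : forall x y, x \in sec_top -> y \in sec_top -> [~ x, y] \in sec_bot
}.

Section Factor.
Variables (G : groupType) (S : abelian_section G).
Local Notation C := (sec_top S).
Local Notation C' := (sec_bot S).

Definition sub_bot : {pred subg C} := fun x => val x \in C'.

Lemma sub_botE x : (x \in sub_bot) = (val x \in C'). Proof. by []. Qed.

Lemma sub_bot1 : 1 \in sub_bot. Proof. exact: gpred1. Qed.
Lemma sub_botM : mulg_closed sub_bot.
Proof. by move=> x y x1 y1; rewrite sub_botE valM gpredM. Qed.
Lemma sub_botV : invg_closed sub_bot.
Proof. by move=> x x1; rewrite sub_botE gmulfV gpredV. Qed.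
Lemma sub_botJ (x g : subg C) : x \in sub_bot -> x ^ g \in sub_bot.
Proof. by move=> x1; rewrite sub_botE gmulfJ gpred_conj. Qed.

Definition sub_bot_normal : normalClosed (subg C) :=
  mk_normal sub_bot1 sub_botM sub_botV sub_botJ.

(* The abelian group C/C', written additively *)
Definition factor : Type := quotg sub_bot_normal.
HB.instance Definition _ := Choice.on factor.

Lemma factor_mulC : commutative (@monoid.mul (quotg sub_bot_normal)).
Proof.
elim/quotW=> x; elim/quotW=> y.
rewrite -!(pi_quotg_morph _).2; apply/eq_modP.
have -> : (x * y)^-1 * (y * x) = [~ y, x].
  by rewrite commgEl conjgE invgM !mulgA.
by rewrite [_ \in _]sub_botE gmulfR sec_comm ?(valP x) ?(valP y).
Qed.

HB.instance Definition _ := GRing.isZmodule.Build factor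
  (@mulgA (quotg sub_bot_normal)) factor_mulC (@mul1g (quotg sub_bot_normal))
  (@mulVg (quotg sub_bot_normal)).

Definition sec_conj (u : subg C) (g : G) : subg C :=
  exist _ (val u ^ g) (gpred_conj _ g (valP u)).

Definition factor_act (x : factor) (q : quotg C) : factor :=
  \pi_(quotg sub_bot_normal)
    (sec_conj (repr (x : quotg sub_bot_normal)) (repr q)).

Lemma factor_actE (u : subg C) (g : G) :
  factor_act (\pi_(quotg sub_bot_normal) u) (\pi_(quotg C) g) =
  \pi_(quotg sub_bot_normal) (sec_conj u g).
Proof.
apply/esym/eq_modP; rewrite [_ \in _]sub_botE gmulfM gmulfV /=.
have := repr_mod sub_bot_normal u; set u' := repr _ => uu'.
have := repr_mod C g; set g' := repr _ => gg'.
have {uu'} : (val u)^-1 * val u' \in C'.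
  by move: uu'; rewrite [_ \in _]sub_botE gmulfM gmulfV.
move=> uu'; have valE (w : subg C) : sval w = val w by [].
rewrite !valE; move: (val u) (val u') uu' (valP u) => v v' vv' vC.
set c := g^-1 * g' in gg'; set d := ((v^-1 * v') ^ g).
have -> : (v ^ g)^-1 * v' ^ g' = [~ v ^ g, c] * d ^ c.
  rewrite commgEl -mulgA -conjMg /d -conjMg mulVKg.
  by rewrite -conjgM /c mulVKg.
by rewrite gpredM ?sec_comm // !gpred_conj.
Qed.

Lemma factor_addE (u v : subg C) :
  ((\pi_(quotg sub_bot_normal) u : factor) +
   (\pi_(quotg sub_bot_normal) v : factor))%R =
  \pi_(quotg sub_bot_normal) (u * v).
Proof. exact/esym/(pi_quotg_morph _).2. Qed.

Lemma factor_actD x y q :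
  factor_act (x + y)%R q = (factor_act x q + factor_act y q)%R.
Proof.
elim/(@quotW _ (quotg sub_bot_normal)): x => u.
elim/(@quotW _ (quotg sub_bot_normal)): y => v.
elim/quotW: q => g; rewrite factor_addE (factor_actE u) (factor_actE v).
rewrite (factor_actE (u * v)) factor_addE.
by congr (\pi _); apply/val_inj; rewrite [RHS]gmulfM; exact: conjMg.
Qed.

Lemma factor_act1 x : factor_act x 1 = x.
Proof.
elim/(@quotW _ (quotg sub_bot_normal)): x => u.
by rewrite factor_actE; congr (\pi _); apply/val_inj; rewrite /= conjg1.
Qed.

Lemma factor_actM x p q : factor_act x (p * q) = factor_act (factor_act x p) q.
Proof.
elim/(@quotW _ (quotg sub_bot_normal)): x => u.
elim/quotW: p => g; elim/quotW: q => h.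
rewrite -(pi_quotg_morph _).2 (factor_actE u (g * h)) (factor_actE u g).
rewrite (factor_actE _ h).
by congr (\pi _); apply/val_inj; exact: conjgM.
Qed.

Local Open Scope ring_scope.

Definition factor_scale (r : (group_ring (quotg C))^c) (x : factor) : factor :=
  \sum_(q <- msupp (r : {malg int[quotg C]}))
     factor_act x q *~ (r : {malg int[quotg C]})@_q.

Implicit Types r s : {malg int[quotg C]}.

Lemma factor_scalew (d : {fset quotg C}) r x : (msupp r `<=` d)%fset ->
  factor_scale r x = \sum_(q <- d) factor_act x q *~ r@_q.
Proof.
move=> rd; rewrite /factor_scale (big_fset_incl _ rd) // => q _.
by move=> /mcoeff_outdom ->; rewrite mulr0z.
Qed.

Lemma factor_scaleU (c : int) (q : quotg C) x :
  factor_scale << c *g q >> x = factor_act x q *~ c.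
Proof. by rewrite (factor_scalew _ msuppU_le) big_seq_fset1 mcoeffUU. Qed.

Lemma factor_scaleDl x :
  {morph factor_scale^~ x : r s / r + s}.
Proof.
move=> r s; set d := (msupp r `|` msupp s)%fset.
rewrite (@factor_scalew d (r + s)) ?msuppD_le//.
rewrite (@factor_scalew d r) ?fsubsetUl// (@factor_scalew d s) ?fsubsetUr//.
by rewrite -big_split; apply: eq_bigr => q _; rewrite mcoeffD mulrzDr.
Qed.

Lemma factor_act0 q : factor_act 0 q = 0.
Proof. by apply: (addrI (factor_act 0 q)); rewrite -factor_actD !addr0. Qed.

Lemma factor_actN x q : factor_act (- x) q = - factor_act x q.
Proof.
by apply: (addrI (factor_act x q)); rewrite -factor_actD !subrr factor_act0.
Qed.

Lemma factor_actMz x q (c : int) : factor_act (x *~ c) q = factor_act x q *~ c.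
Proof.
have actMn n : factor_act (x *+ n) q = factor_act x q *+ n.
  elim: n => [|n IH]; first exact: factor_act0.
  by rewrite !mulrS factor_actD IH.
by case: c => n; rewrite ?NegzE ?mulrNz ?factor_actN -!pmulrn actMn.
Qed.

Lemma factor_scaleDr r : {morph factor_scale r : x y / x + y}.
Proof.
move=> x y; rewrite /factor_scale -big_split; apply: eq_bigr => q _ /=.
by rewrite factor_actD mulrzDl.
Qed.

Lemma factor_scaler0 r : factor_scale r 0 = 0.
Proof. by rewrite /factor_scale big1 // => q _; rewrite factor_act0 mul0rz. Qed.

Lemma factor_scale0r x : factor_scale 0 x = 0.
Proof.
by rewrite /factor_scale [X in msupp X]/(0 : {malg _}) msupp0 big_seq_fset0.
Qed.

Lemma factor_scaleA (r s : (group_ring (quotg C))^c) x :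
  factor_scale r (factor_scale s x) = factor_scale (r * s) x.
Proof.
rewrite -[r * s]/(gr_mul s r).
rewrite (monalgE s) gr_suml.
rewrite !(big_morph (factor_scale^~ _) (factor_scaleDl _) (factor_scale0r _)).
rewrite (big_morph (factor_scale r) (factor_scaleDr _) (factor_scaler0 _)).
apply: eq_bigr => p _; rewrite (monalgE r) gr_sumr.
rewrite !(big_morph (factor_scale^~ _) (factor_scaleDl _) (factor_scale0r _)).
apply: eq_bigr => q _.
by rewrite gr_mulUU !factor_scaleU factor_actMz -factor_actM mulrzA.
Qed.

Lemma factor_scale1 x : factor_scale 1 x = x.
Proof. by rewrite [LHS]factor_scaleU mulr1z factor_act1. Qed.

HB.instance Definition _ := GRing.Zmodule_isLmodule.Build
  (group_ring (quotg C))^c factor factor_scaleA factor_scale1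
  factor_scaleDr (fun x r s => factor_scaleDl x r s).

Definition section_module : lmodType (group_ring (quotg C))^c := factor.
End Factor.

Section Rigid.
Variables (G : groupType) (n : nat).

(* G_(i+1) is [term i], for 0 <= i <= n; the other values are irrelevant. *)
Record abelian_series := AbelianSeries {
  term : nat -> normalClosed G;
  term_first : forall x, x \in term 0;
  term_last : forall x, x \in term n -> x = 1;
  term_sub : forall i : 'I_n, forall x, x \in term i.+1 -> x \in term i;
  term_comm : forall i : 'I_n, forall x y,
    x \in term i -> y \in term i -> [~ x, y] \in term i.+1
}.

Definition series_section (s : abelian_series) (i : 'I_n) : abelian_section G :=
  AbelianSection (@term_sub s i) (@term_comm s i).

Definition series_ring (s : abelian_series) (i : 'I_n) : nzRingType :=
  group_ring (quotg (term s i)).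

Definition series_factor (s : abelian_series) (i : 'I_n) :
    lmodType (series_ring s i)^c :=
  section_module (series_section s i).

Definition principal_series (s : abelian_series) : Prop :=
  forall i : 'I_n,
    (exists2 x, x \in term s i & x \notin term s i.+1) /\
    no_torsion (series_factor s i).
End Rigid.

Definition n_rigid (n : nat) (G : groupType) : Prop :=
  solvability_class G n /\ exists s : abelian_series G n, principal_series s.

(* Main.v *)
(* In a principal series A = A_0 > A_1 > ... > A_n = 1 membership in A_i is
   detected by a commutator with one element of A_i outside A_(i+1), hence by a
   single equation; so every principal series of the coordinate group G of S
   has as terms the pointwise preimages of the A_i under evaluation at the
   points of S.  Irreducibility of S provides a point at which finitely many
   given elements stay outside prescribed terms.  Evaluation there shows that
   the factors of G have no torsion and that a family independent over A stays
   independent over G, which gives r_i(A) <= r_i(G).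

   For the upper bound let Q = G / G_i and T = G_i / G_(i+1).  The augmentation
   ideal of Z[G] modulo its product with K = ker (Z[G] -> Z[Q]) is a right
   Z[Q]-module containing T, spanned by the g - 1 for g among the generators of
   G, that is the m variables and the elements of A.  Modulo torsion the latter
   contribute only r_i(A) elements of T and one element y - 1.  As a solvable
   group Q is amenable, so over Z[Q] a homogeneous linear system with more
   unknowns than equations has a nonzero solution; dimension counting then
   yields r_i(G) <= m + r_i(A). *)

Require Import Defs.
From HB Require Import structures.
From mathcomp Require Import finmap monalg.
From mathcomp Require Import all_boot all_order all_algebra generic_quotient.
From mathcomp Require Import boolp classical_sets functions cardinality.
From mathcomp Require Import topology_structure zify.

Set Implicit Arguments.
Unset Strict Implicit.
Unset Printing Implicit Defensive.

Import GRing.Theory.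

(** * Amenability of solvable groups *)

(** For [k > 0], Bernoulli gives (1 + 1/k)^k >= 2, so at l = k s the ratio (k + 1)^l / k^l is at
    least 2^s, which outgrows every fixed power of k s + 1. *)
Lemma exp_beats_poly (k t : nat) : exists l, k ^ l * l.+1 ^ t < k.+1 ^ l.
Proof.
case: k => [|k]; first by exists 1.
have bern : 2 * k.+1 ^ k.+1 <= k.+2 ^ k.+1.
  rewrite -(addn1 k.+1) expnDn mul2n -addnn big_ord_recl big_ord_recl /=.
  by rewrite !exp1n !muln1 bin0 bin1 mul1n subn0 subSS subn0 -expnS addnA leq_addr.
have [p ltp] : exists p, (k.+1 + p) * t < 2 ^ p.
  (* With p = 2q, where q bounds both k + 1 and 3t: (k + 1 + p) t <= 3qt <= q^2 < (q + 1)^2 <=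
     2^p. *)
  exists ((k.+1 + 3 * t).*2); move eq_q: (k.+1 + 3 * t) => q.
  apply: (@leq_trans (q.+1 * q.+1)); first by rewrite -mul2n; nia.
  by rewrite -addnn expnD; apply: leq_mul; apply: ltn_expl.
have [s lts] : exists s, (k.+1 * s).+1 ^ t < 2 ^ s.
  (* With s = 2^p, (k + 1) s + 1 is at most 2^(k + 1 + p), whose [t]-th power is below 2^s by the
     choice of [p]. *)
  exists (2 ^ p); apply: (@leq_ltn_trans (2 ^ ((k.+1 + p) * t))); last by rewrite ltn_exp2l.
  case: t ltp => [|t] _; first by rewrite muln0 !expn0.
  rewrite expnM leq_exp2r //; apply: (@leq_trans (k.+2 * 2 ^ p)).
    by rewrite mulSn -add1n leq_add2r expn_gt0.
  by rewrite expnD leq_mul2r (ltn_expl k.+1) ?orbT.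
exists (k.+1 * s); rewrite !expnM.
apply: (@leq_trans ((2 * k.+1 ^ k.+1) ^ s)).
  by rewrite expnMn mulnC ltn_pmul2r // !expn_gt0.
by case: (posnP s) => [->|s0]; rewrite ?expn0 // leq_exp2r.
Qed.

(** If every step multiplied [f] by at least (k + 1)/k, then k^l f(l) >= (k + 1)^l for all l,
    against the polynomial bound. *)
Lemma slow_growth (f : nat -> nat) (k t : nat) :
  0 < f 0 -> (forall l, f l <= l.+1 ^ t) -> exists l, k * f l.+1 < k.+1 * f l.
Proof.
move=> f0 fle; apply: contrapT => /forallNP fgrow.
have [l] := exp_beats_poly k t; apply/negP; rewrite -leqNgt.
apply: (@leq_trans (k ^ l * f l)); last by rewrite leq_mul2l fle orbT.
elim: l => [|l IH]; first by rewrite !expn0 mul1n.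
have := fgrow l; move/negP; rewrite -leqNgt => kf.
rewrite (expnS k.+1) (expnSr k) -mulnA; apply: leq_trans (leq_mul (leqnn _) kf).
by rewrite mulnCA leq_mul2l IH orbT.
Qed.

(* A Folner condition without ratios: [D] contains [F * B] and is at most
   [1 + 1/k] times larger than [B]. *)
Definition folner_pair (Q : groupType) (F B D : seq Q) (k : nat) : Prop :=
  [/\ uniq B, (forall f b, f \in F -> b \in B -> (f * b)%g \in D)
    & k * size D < k.+1 * size B].

Definition folner (Q : groupType) : Prop :=
  forall (F : seq Q) (k : nat), exists B D : seq Q, folner_pair F B D k.

Section FolnerAbelian.
Variables (Q : groupType) (P : Q -> Prop).
Hypothesis P1 : P 1%g.
Hypothesis PM : forall x y, P x -> P y -> P (x * y)%g.
Hypothesis Pcomm : forall x y, P x -> P y -> commute x y.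

(** Products of powers of the elements of [F] with exponents at most [l], kept as a list with
    repetitions so that its length is exactly a power of [l.+1]. *)
Let box (F : seq Q) l : seq Q :=
  foldr (fun e B => [seq (e ^+ i * x)%g | i <- iota 0 l.+1, x <- B]) [:: 1%g] F.

Let PX x n : P x -> P (x ^+ n)%g.
Proof. by move=> Px; elim: n => [|n IH]; rewrite ?expg0 // expgS; apply: PM. Qed.

Let box_cons e F l :
  box (e :: F) l = [seq (e ^+ i * x)%g | i <- iota 0 l.+1, x <- box F l].
Proof. by []. Qed.

Let size_box F l : size (box F l) = l.+1 ^ size F.
Proof.
elim: F => [//|e F IH].
by rewrite box_cons size_allpairs size_iota IH [size (_ :: _)]/= expnS.
Qed.

Let box_P F l : (forall e, e \in F -> P e) -> forall x, x \in box F l -> P x.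
Proof.
elim: F => [|e F IH] FP x; first by rewrite inE => /eqP->.
rewrite box_cons; case/allpairsP=> [[i y] [_ yB ->]] /=; apply: PM.
  by apply: PX; apply: FP; rewrite mem_head.
by apply: IH yB => z zF; apply: FP; rewrite inE zF orbT.
Qed.

Let box_sub F l x : x \in box F l -> x \in box F l.+1.
Proof.
elim: F x => [//|e F IH] x; rewrite !box_cons => /allpairsP[[i y] [il yB ->]].
apply/allpairsP; exists (i, y); split=> //; last exact: IH.
by move: il; rewrite !mem_iota /=; lia.
Qed.

Let box_step F l f x : (forall e, e \in F -> P e) -> f \in F ->
  x \in box F l -> (f * x)%g \in box F l.+1.
Proof.
elim: F x => [//|e F IH] x FP; rewrite inE !box_cons => /predU1P[->|fF];
  case/allpairsP=> [[i y] [il yB ->]]; apply/allpairsP.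
  exists (i.+1, y); split; [|exact: box_sub|by rewrite expgS mulgA].
  by move: il; rewrite !mem_iota /=; lia.
exists (i, f * y)%g; split.
- by move: il; rewrite !mem_iota /=; lia.
- by apply: IH => // z zF; apply: FP; rewrite inE zF orbT.
rewrite !mulgA; congr (_ * _)%g; apply: Pcomm.
  by apply: FP; rewrite inE fF orbT.
by apply: PX; apply: FP; rewrite mem_head.
Qed.

(* The boxes of exponents grow polynomially, so some box is almost invariant. *)
Lemma folner_abelian (F : seq Q) k : (forall e, e \in F -> P e) ->
  exists B D : seq Q, folner_pair F B D k /\ forall b, b \in B -> P b.
Proof.
move=> FP; pose E l := undup (box F l).
have [l El] : exists l, k * size (E l.+1) < k.+1 * size (E l).
  apply: (@slow_growth _ _ (size F)) => [|l]; last by rewrite -size_box size_undup.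
  have : 1%g \in E 0.
    rewrite /E mem_undup; elim: (F) => [|e F0 IH]; first by rewrite inE.
    by rewrite box_cons; apply/allpairsP; exists (0, 1%g); rewrite expg0 mulg1.
  by case: (E 0).
exists (E l), (E l.+1); split; last by move=> b; rewrite mem_undup; apply: box_P.
split=> //; first exact: undup_uniq.
by move=> f b fF; rewrite !mem_undup; apply: box_step.
Qed.
End FolnerAbelian.

Lemma folner_trivial (Q : groupType) : (forall q : Q, q = 1%g) -> folner Q.
Proof.
move=> Q1 F k; exists [:: 1%g], [:: 1%g]; split=> [//|f b _ _|/=].
  by rewrite inE (Q1 (f * b)%g).
by rewrite !muln1.
Qed.

(** A section [s] of [p] lifts a Folner pair of [Q]. Its defect, given by f s(b) = s(p(f) b) nu(f,
    b), lies in the abelian kernel; a Folner pair there for these finitely many defects is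
    multiplied with the lifted one. *)
Lemma folner_extension (Q' Q : groupType) (p : UMagmaMorphism.type Q' Q) :
    (forall q, exists x, p x = q) ->
    (forall x y, p x = 1%g -> p y = 1%g -> commute x y) ->
  folner Q -> folner Q'.
Proof.
move=> /choice[s sK] pcomm folQ F k.
(* The parameter 2k + 1 serves for both pairs, since k (2k + 2)^2 <= (k + 1) (2k + 1)^2. *)
have [B [D [uB FBD sBD]]] := folQ [seq p f | f <- F] (2 * k).+1.
pose nu f b := ((s (p f * b))^-1 * (f * s b))%g.
have nuK f b : p (nu f b) = 1%g by rewrite /nu !gmulfM gmulfV !sK mulVg.
have p1 : p 1%g = 1%g by exact: gmulf1.
have pM x y : p x = 1%g -> p y = 1%g -> p (x * y)%g = 1%g.
  by move=> xK yK; rewrite gmulfM xK yK mulg1.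
have [|B' [D' [[uB' FBD' sBD'] B'K]]] := folner_abelian p1 pM pcomm
  (F := [seq nu f b | f <- F, b <- B]) (2 * k).+1.
  by move=> e /allpairsP[[f b] [_ _ ->]].
exists [seq (s b * x)%g | b <- B, x <- B'], [seq (s b * x)%g | b <- D, x <- D'].
split.
- apply: allpairs_uniq => // -[b x] [c y] /allpairsP[[b' x'] /= [_ xB' [_ ->]]].
  move=> /allpairsP[[c' y'] /= [_ yB' [_ ->]]] /= eqbc.
  have bc : b = c.
    by have := congr1 p eqbc; rewrite !gmulfM !sK (B'K _ xB') (B'K _ yB') !mulg1.
  by move: eqbc; rewrite bc => /mulgI->.
- move=> f z fF /allpairsP[[b x] /= [bB xB' ->]]; apply/allpairsP.
  exists (p f * b, nu f b * x)%g; split=> /=.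
  + by apply: FBD => //; apply: map_f.
  + by apply: FBD' => //; apply/allpairsP; exists (f, b).
  + by rewrite /nu !mulgA mulgV mul1g.
rewrite !size_allpairs.
move: (size B) (size D) (size B') (size D') sBD sBD' => b d b' d' bd bd'.
have num : k * ((2 * k).+2 * (2 * k).+2) <= k.+1 * ((2 * k).+1 * (2 * k).+1) by nia.
have lt_prod := ltn_mul bd bd'; rewrite mulnACA [ltnRHS]mulnACA in lt_prod.
have k0 : 0 < (2 * k).+2 * (2 * k).+2 by [].
rewrite -(ltn_pmul2l k0) mulnCA mulnA.
apply: leq_ltn_trans (leq_mul num (leqnn _)) _.
by rewrite -mulnA [ltnRHS]mulnCA ltn_pmul2l.
Qed.

Local Open Scope ring_scope.

(** * Group rings *)

Section GroupRingExtension.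
Variables (Q : groupType) (V : zmodType).
Implicit Types (h : Q -> V) (r s : {malg int[Q]}).

Definition gr_gen (q : Q) : group_ring Q := << (1 : int) *g q >>.

Definition gr_ext h (r : group_ring Q) : V :=
  \sum_(q <- msupp (r : {malg int[Q]})) h q *~ (r : {malg int[Q]})@_q.

Lemma gr_extw h (d : {fset Q}) r : (msupp r `<=` d)%fset ->
  gr_ext h r = \sum_(q <- d) h q *~ r@_q.
Proof.
move=> rd; rewrite /gr_ext (big_fset_incl _ rd) // => q _.
by move=> /mcoeff_outdom ->; rewrite mulr0z.
Qed.

Lemma gr_ext_is_additive h : zmod_morphism (gr_ext h).
Proof.
move=> r s; set d := (msupp (r : {malg int[Q]}) `|` msupp (s : {malg int[Q]}))%fset.
rewrite (@gr_extw h d (r - s)) ?msuppB_le//.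
rewrite (@gr_extw h d r) ?fsubsetUl// (@gr_extw h d s) ?fsubsetUr//.
by rewrite -sumrB; apply: eq_bigr => q _; rewrite mcoeffB mulrzBr.
Qed.
HB.instance Definition _ h := GRing.isZmodMorphism.Build (group_ring Q) V
  (gr_ext h) (gr_ext_is_additive h).

Lemma gr_extU h c q : gr_ext h << c *g q >> = h q *~ c.
Proof. by rewrite (gr_extw _ msuppU_le) big_seq_fset1 mcoeffUU. Qed.

Lemma gr_ext_gen h q : gr_ext h (gr_gen q) = h q.
Proof. exact: gr_extU. Qed.

End GroupRingExtension.

Section Coefficients.
Variable Q : groupType.
Implicit Types r s : group_ring Q.

Definition gr_coef (q : Q) (r : group_ring Q) : int := (r : {malg int[Q]})@_q.
HB.instance Definition _ q := GRing.Additive.copy (gr_coef q) (mcoeff q : {malg int[Q]}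
  -> int).

Definition gr_supp r : seq Q := msupp (r : {malg int[Q]}).

Lemma gr_coef_gen p q : gr_coef q (gr_gen p) = (p == q)%:R.
Proof. exact: mcoeffU. Qed.

Lemma gr_coefP r s : (forall q, gr_coef q r = gr_coef q s) -> r = s.
Proof. by move=> rs; apply/malgP. Qed.

Lemma gr_gen_inj : injective (@gr_gen Q).
Proof.
move=> p q /(congr1 (gr_coef q)); rewrite !gr_coef_gen eqxx.
by case: eqP => // _ /eqP; rewrite eq_sym oner_eq0.
Qed.

Lemma gr_suppN q r : q \notin gr_supp r -> gr_coef q r = 0.
Proof. exact: mcoeff_outdom. Qed.

Lemma gr_genE r : r = \sum_(q <- gr_supp r) gr_gen q *~ gr_coef q r.
Proof.
rewrite [LHS](monalgE (r : {malg int[Q]})); apply: eq_bigr => q _.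
by rewrite -(raddfMz (@mkmalgU Q int q)) intz.
Qed.

Lemma gr_coef_sum q (J : Type) (e : seq J) (p : J -> Q) (z : J -> int) :
  gr_coef q (\sum_(j <- e) gr_gen (p j) *~ z j) = \sum_(j <- e | p j == q) z j.
Proof.
rewrite raddf_sum /= [RHS]big_mkcond /=; apply: eq_bigr => j _.
by rewrite raddfMz /= gr_coef_gen; case: eqP => _; rewrite ?intz ?mul0rz.
Qed.
End Coefficients.

(** Group elements generate Z[Q] additively, and closure under subtraction already yields zero,
    opposites and sums. Additive identities are thereby reduced to group elements. *)
Lemma gr_ind (Q : groupType) (P : group_ring Q -> Prop) :
    (forall q, P (gr_gen q)) -> (forall r s, P r -> P s -> P (r - s)) ->
  forall r, P r.
Proof.
move=> Pgen PB r; have P0 : P 0 by rewrite -(subrr (gr_gen 1%g)); apply: PB.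
have PN s : P s -> P (- s) by rewrite -sub0r; apply: PB.
have PD s t : P s -> P t -> P (s + t) by move=> Ps /PN; rewrite -{2}[t]opprK; apply: PB.
rewrite (gr_genE r); elim/big_ind: _ => // q _.
have PMn n : P (gr_gen q *+ n) by elim: n => // n IH; rewrite mulrS; apply: PD.
by case: (gr_coef _ _) => n; rewrite ?NegzE ?mulrNz; [|apply: PN]; apply: PMn.
Qed.

Lemma gr_genM (Q : groupType) (p q : Q) : gr_gen p * gr_gen q = gr_gen (p * q)%g.
Proof. exact: gr_mulUU. Qed.

Lemma gr_gen1 (Q : groupType) : gr_gen (1%g : Q) = 1.
Proof. by []. Qed.


Section GroupRingMap.
Variables (Q Q' : groupType).

Definition gr_map (f : Q -> Q') : group_ring Q -> group_ring Q' :=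
  gr_ext (fun q => gr_gen (f q)).
HB.instance Definition _ f := GRing.Additive.copy (gr_map f) (gr_ext (fun q => gr_gen (f
  q))).

Lemma gr_map_gen f q : gr_map f (gr_gen q) = gr_gen (f q).
Proof. exact: gr_ext_gen. Qed.

Lemma gr_coef_map_sum f r q :
  gr_coef q (gr_map f r) = \sum_(p <- gr_supp r | f p == q) gr_coef p r.
Proof. exact: gr_coef_sum. Qed.

(** No two terms of [r] merge, so each coefficient survives. Injectivity is asked on the finite
    support alone because evaluation at one point cannot guarantee more. *)
Lemma gr_map_neq0 f r : r != 0 ->
  (forall p q, p \in gr_supp r -> q \in gr_supp r -> f p = f q -> p = q) ->
  gr_map f r != 0.
Proof.
move=> r0 finj; have [q qr] : exists q, gr_coef q r != 0.
  apply: contrapT => /forallNP r1; case/eqP: r0; apply: gr_coefP => q.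
  by rewrite raddf0; apply/eqP/negPn/negP/r1.
have qs : q \in gr_supp r.
  by apply: contraNT qr => /gr_suppN q0; apply/eqP.
apply: contraNneq qr => /(congr1 (gr_coef (f q))); rewrite raddf0 gr_coef_map_sum.
rewrite big_mkcond (bigD1_seq q qs) ?fset_uniq //= eqxx.
rewrite big_seq_cond big1 ?addr0 => [->//|p /andP[ps pq]].
by case: ifP => // /eqP/(finj _ _ ps qs) e; rewrite e eqxx in pq.
Qed.

Lemma gr_ext_map (V : zmodType) (h : Q' -> V) f r :
  gr_ext h (gr_map f r) = gr_ext (h \o f) r.
Proof.
elim/gr_ind: r => [q|r s IHr IHs]; first by rewrite gr_map_gen !gr_ext_gen.
by rewrite !raddfB /= IHr IHs.
Qed.

Variable f : UMagmaMorphism.type Q Q'.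

Lemma gr_map_monoid : monoid_morphism (gr_map f).
Proof.
split=> [|r s]; first by rewrite -!gr_gen1 gr_map_gen gmulf1.
elim/gr_ind: r => [p|r r' IHr IHr']; last by rewrite mulrBl !raddfB /= mulrBl IHr IHr'.
elim/gr_ind: s => [q|s s' IHs IHs']; last by rewrite mulrBr !raddfB /= mulrBr IHs IHs'.
by rewrite gr_genM !gr_map_gen gr_genM gmulfM.
Qed.
HB.instance Definition _ := GRing.isMonoidMorphism.Build
  (group_ring Q) (group_ring Q') (gr_map f) gr_map_monoid.

Hypothesis f_inj : injective f.
Lemma gr_coef_map r q : gr_coef (f q) (gr_map f r) = gr_coef q r.
Proof.
elim/gr_ind: r => [p|r s IHr IHs]; last by rewrite !raddfB /= IHr IHs.
by rewrite gr_map_gen !gr_coef_gen (inj_eq f_inj).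
Qed.

Lemma gr_map_inj : injective (gr_map f).
Proof. by move=> r s rs; apply/gr_coefP => q; rewrite -!gr_coef_map rs. Qed.
End GroupRingMap.

(** * Homogeneous linear systems over the integers and over group rings *)

Lemma int_system (I J : finType) (M : I -> J -> int) : (#|I| < #|J|)%N ->
  exists2 z : J -> int, (exists j, z j != 0) & forall i, \sum_j M i j * z j = 0.
Proof.
move=> ltIJ.
pose N : 'M[rat]_(#|J|, #|I|) := \matrix_(j, i) (M (enum_val i) (enum_val j))%:~R.
have /rowV0Pn[v /sub_kermxP vN v0] : kermx N != 0.
  by rewrite -mxrank_eq0 mxrank_ker -lt0n subn_gt0 (leq_ltn_trans (rank_leq_col _)).
have [k vk0] : exists k, v 0 k != 0.
  apply/existsP; rewrite -negb_forall; apply: contra v0 => /forallP vk.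
  by apply/eqP/rowP => k; rewrite mxE; apply/eqP/vk.
(* A rational kernel vector is made integral by multiplying with the product of all its
   denominators. *)
pose d : rat := \prod_k (denq (v 0 k))%:~R.
have d0 : d != 0 by apply/prodf_neq0 => l _; rewrite intr_eq0 denq_eq0.
pose z l : int := numq (v 0 l) * \prod_(k | k != l) denq (v 0 k).
have zE l : (z l)%:~R = v 0 l * d.
  by rewrite /d (bigD1 l) //= mulrA -numqE rmorphM rmorph_prod.
exists (z \o enum_rank).
  exists (enum_val k); rewrite /= enum_valK -(intr_eq0 rat) zE mulf_neq0 //.
move=> i; apply/eqP; rewrite -(intr_eq0 rat) rmorph_sum /=; apply/eqP.
have /rowP/(_ (enum_rank i)) := vN; rewrite !mxE => vNi.
transitivity ((\sum_j v 0 j * N j (enum_rank i)) * d); last by rewrite vNi mul0r.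
rewrite mulr_suml [RHS](reindex enum_rank) /=; last exact/onW_bij/enum_rank_bij.
by apply: eq_bigr => j _; rewrite intrM zE mxE !enum_rankK mulrCA mulrA.
Qed.

(* Unknowns supported on [B] give integer equations indexed by [D]. *)
Lemma gr_system_solvable (Q : groupType) (I J : finType)
    (M : I -> J -> group_ring Q) : folner Q -> (#|I| < #|J|)%N ->
  exists2 c : J -> group_ring Q, (exists j, c j != 0) &
    forall i, \sum_j M i j * c j = 0.
Proof.
move=> folQ ltIJ.
pose F := flatten [seq gr_supp (M p.1 p.2) | p : I * J].
(* The parameter |I| gives |I| |D| < (|I| + 1) |B| <= |J| |B|: fewer integer equations than integer
   unknowns. *)
have [B [D [uB FBD sBD]]] := folQ F #|I|.
have sBD' : (#|{: I * 'I_(size D)}| < #|{: J * 'I_(size B)}|)%N.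
  rewrite !card_prod !card_ord; apply: leq_trans sBD _.
  by rewrite leq_mul2r ltIJ orbT.
pose bt (b : 'I_(size B)) := tnth (in_tuple B) b.
have bt_inj : injective bt by apply/tuple_uniqP.
pose C (x : I * 'I_(size D)) (y : J * 'I_(size B)) : int :=
  gr_coef (tnth (in_tuple D) x.2) (M x.1 y.1 * gr_gen (bt y.2)).
have [z [[j0 b0] zj0] zC] := int_system C sBD'.
pose c j : group_ring Q := \sum_b gr_gen (bt b) *~ z (j, b).
exists c => [|i].
  exists j0; apply: contraNneq zj0 => /(congr1 (gr_coef (bt b0))).
  rewrite raddf0 gr_coef_sum (eq_bigl (pred1 b0)) ?big_pred1_eq => [->//|b].
  by rewrite (inj_eq bt_inj).
have McE q : gr_coef q (\sum_j M i j * c j) =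
    \sum_(y : J * 'I_(size B)) gr_coef q (M i y.1 * gr_gen (bt y.2)) * z y.
  transitivity (\sum_j \sum_b gr_coef q (M i j * gr_gen (bt b)) * z (j, b)); last first.
    by rewrite pair_bigA; apply: eq_bigr => -[].
  rewrite raddf_sum; apply: eq_bigr => j _; rewrite mulr_sumr raddf_sum.
  by apply: eq_bigr => b _; rewrite mulrzAr raddfMz -mulrzr intz.
apply: gr_coefP => q; rewrite McE raddf0.
(* Inside [D] the coefficient is one of the solved equations; outside it vanishes, since [D]
   contains all products of support elements with [B]. *)
have [/tnthP[l ->]|qD] := boolP (q \in in_tuple D); first exact: (zC (i, l)).
rewrite big1 // => y _.
suff -> : gr_coef q (M i y.1 * gr_gen (bt y.2)) = 0 by rewrite mul0r.
rewrite (gr_genE (M i y.1)) mulr_suml raddf_sum /= big_seq big1 // => f fM.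
rewrite mulrzAl raddfMz /= gr_genM gr_coef_gen.
case: eqP => [fq|]; last by rewrite mul0rz.
case/negP: qD; rewrite -fq; apply: FBD; last exact: mem_tnth.
by apply/flattenP; exists (gr_supp (M i y.1)) => //; apply/mapP; exists (i, y.1);
  rewrite ?mem_enum.
Qed.

Local Open Scope quotient_scope.

(** * Sections of a group as modules *)

Section QuotientMap.
Variables (G : groupType) (N : normalClosed G).

Definition qpi (x : G) : quotg N := \pi_(quotg N) x.
HB.instance Definition _ := isUMagmaMorphism.Build G (quotg N) qpi (pi_quotg_morph N).

Lemma qpiP x y : reflect (qpi x = qpi y) (x^-1 * y \in N)%g.
Proof. exact: eq_modP. Qed.

Lemma qpi_eq1 x : (qpi x = 1%g) <-> (x \in N).
Proof.
rewrite -gpredV -[x^-1%g]mulg1; split=> [x1|/qpiP->//].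
by apply/qpiP; rewrite x1 gmulf1.
Qed.

Lemma qreprK (q : quotg N) : qpi (repr q) = q.
Proof. exact: reprK. Qed.
End QuotientMap.

Section QuotientMorphism.
Variables (G H : groupType) (N : normalClosed G) (M : normalClosed H).
Variable f : UMagmaMorphism.type G H.
Hypothesis fNM : forall x, x \in N -> f x \in M.

Definition qmap (q : quotg N) : quotg M := qpi M (f (repr q)).

Lemma qmapE x : qmap (qpi N x) = qpi M (f x).
Proof.
by apply/esym/qpiP; rewrite -gmulfV -gmulfM; apply/fNM/qpiP; rewrite qreprK.
Qed.

Lemma qmap_monoid : monoid.monoid_morphism qmap.
Proof.
split=> [|p q]; first by have := qmapE 1%g; rewrite !gmulf1.
by rewrite -(qreprK p) -(qreprK q) -gmulfM !qmapE !gmulfM.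
Qed.

Definition qmorph : UMagmaMorphism.type (quotg N) (quotg M) :=
  HB.pack qmap (isUMagmaMorphism.Build (quotg N) (quotg M) qmap qmap_monoid).

Lemma qmorphE x : qmorph (qpi N x) = qpi M (f x).
Proof. exact: qmapE. Qed.

Lemma qmorph_inj : (forall x, f x \in M -> x \in N) -> injective qmorph.
Proof.
move=> MfN p q; rewrite -(qreprK p) -(qreprK q) !qmorphE => /qpiP.
by rewrite -gmulfV -gmulfM => /MfN/qpiP.
Qed.
End QuotientMorphism.


Section RightAction.
Variables (R : nzRingType) (T : lmodType R^c).
Implicit Types (x y : T) (r s : R).

Definition ract x r : T := (r : R^c) *: x.
Local Notation "x *> r" := (ract x r) (at level 40, left associativity).

Lemma ractA x r s : x *> r *> s = x *> (r * s).
Proof. exact: scalerA. Qed.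
Lemma ract1 x : x *> 1 = x.
Proof. exact: scale1r. Qed.
Lemma ractDl x y r : (x + y) *> r = x *> r + y *> r.
Proof. exact: scalerDr. Qed.
Lemma ractBl x y r : (x - y) *> r = x *> r - y *> r.
Proof. exact: scalerBr. Qed.
Lemma ractBr x r s : x *> (r - s) = x *> r - x *> s.
Proof. exact: scalerBl. Qed.
Lemma ractDr x r s : x *> (r + s) = x *> r + x *> s.
Proof. exact: scalerDl. Qed.
Lemma ract0r x : x *> 0 = 0.
Proof. exact: scale0r. Qed.
Lemma ract_suml I (e : seq I) P (F : I -> T) r :
  (\sum_(i <- e | P i) F i) *> r = \sum_(i <- e | P i) F i *> r.
Proof. exact: scaler_sumr. Qed.
Lemma ract_sumr I (e : seq I) P (F : I -> R) x :
  x *> (\sum_(i <- e | P i) F i) = \sum_(i <- e | P i) x *> F i.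
Proof. exact: scaler_suml. Qed.
End RightAction.

Notation "x *> r" := (ract x r) (at level 40, left associativity) : ring_scope.

Section SectionClass.
Variables (G : groupType) (S : abelian_section G).
Local Notation C := (sec_top S).
Local Notation C' := (sec_bot S).
Local Notation T := (section_module S).

(** Made total by the default value 0 outside [C], so that classes of plain group elements carry no
    membership proof. *)
Definition sec_class (x : G) : T :=
  if insub x is Some u then \pi_(quotg (sub_bot_normal S)) (u : subg C) else 0.

Lemma sec_classE (u : subg C) :
  sec_class (val u) = \pi_(quotg (sub_bot_normal S)) u.
Proof. by rewrite /sec_class valK. Qed.

Lemma sec_classM x y : x \in C -> y \in C ->
  sec_class (x * y)%g = sec_class x + sec_class y.
Proof.
move=> xC yC; pose u : subg C := exist _ x xC; pose v : subg C := exist _ y yC.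
have -> : (x * y)%g = val (u * v)%g by rewrite gmulfM.
by rewrite sec_classE -[x]/(val u) -[y]/(val v) !sec_classE [RHS]factor_addE.
Qed.

Lemma sec_class_eq x y : x \in C -> y \in C ->
  sec_class x = sec_class y <-> (x^-1 * y \in C')%g.
Proof.
move=> xC yC; pose u : subg C := exist _ x xC; pose v : subg C := exist _ y yC.
rewrite -[x]/(val u) -[y]/(val v) !sec_classE -gmulfV -gmulfM.
by split=> [/eq_modP//|uv]; apply/eq_modP.
Qed.

Lemma sec_class1 : sec_class 1%g = 0.
Proof. by apply: (addIr (sec_class 1%g)); rewrite -sec_classM ?gpred1 // mulg1 add0r. Qed.

Lemma sec_class_eq0 x : x \in C -> sec_class x = 0 <-> x \in C'.
Proof.
move=> xC; rewrite -sec_class1; split=> [/esym|] x1.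
  by move/(sec_class_eq gpred1 xC): x1; rewrite invg1 mul1g.
by apply/esym/(sec_class_eq gpred1 xC); rewrite invg1 mul1g.
Qed.

Lemma sec_classJ x g : x \in C ->
  sec_class (x ^ g)%g = sec_class x *> gr_gen (qpi C g).
Proof.
move=> xC; pose u : subg C := exist _ x xC.
have -> : (x ^ g)%g = val (sec_conj u g) by [].
rewrite sec_classE -[x]/(val u) sec_classE -factor_actE.
by rewrite /ract [RHS]factor_scaleU mulr1z.
Qed.

Definition sec_repr (t : T) : G := val (repr (t : quotg (sub_bot_normal S))).

Lemma sec_repr_top t : sec_repr t \in C.
Proof. exact: valP. Qed.

Lemma sec_reprK t : sec_class (sec_repr t) = t.
Proof. by rewrite sec_classE reprK. Qed.

End SectionClass.

(** * The map from relations to the module *)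

Section Theta.
Variables (G : groupType) (S : abelian_section G).
Local Notation C := (sec_top S).
Local Notation T := (section_module S).
Implicit Types (x y : group_ring G).

Definition gr_quot : group_ring G -> group_ring (quotg C) := gr_map (qpi C).
HB.instance Definition _ := GRing.RMorphism.copy gr_quot (gr_map (qpi C)).

Lemma gr_quot_gen g : gr_quot (gr_gen g) = gr_gen (qpi C g).
Proof. exact: gr_map_gen. Qed.

Lemma gr_quot_surj r : exists x, gr_quot x = r.
Proof.
elim/gr_ind: r => [q|r s [x <-] [y <-]]; last by exists (x - y); rewrite raddfB.
by exists (gr_gen (repr q)); rewrite gr_quot_gen qreprK.
Qed.

(** A function constant on the cosets of [C] factors through the quotient, hence so does its
    additive extension. Identities on the kernel of [gr_quot] follow by applying this to the
    difference of their sides. *)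
Lemma gr_ext_coset (V : zmodType) (h : G -> V) x :
  (forall g c, c \in C -> h (g * c)%g = h g) -> gr_quot x = 0 -> gr_ext h x = 0.
Proof.
move=> hC x0; have -> : h = (fun q => h (repr q)) \o qpi C.
  apply/funext => g /=; rewrite -[RHS](hC _ ((repr (qpi C g))^-1 * g)%g) ?mulVKg //.
  by apply/qpiP; rewrite qreprK.
by rewrite -gr_ext_map -/(gr_quot x) x0 raddf0.
Qed.

(* [theta] depends on the transversal [repr]; only its restriction to the
   kernel of [gr_quot], where [g c - g] goes to the class of [c], is canonical. *)
Definition theta_gen (g : G) : T := sec_class S ((repr (qpi C g))^-1 * g)%g.
Definition theta : group_ring G -> T := gr_ext theta_gen.
HB.instance Definition _ := GRing.Additive.copy theta (gr_ext theta_gen).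

Lemma theta_genM g c : c \in C -> theta_gen (g * c)%g = theta_gen g + sec_class S c.
Proof.
move=> cC; rewrite /theta_gen; have -> : qpi C (g * c)%g = qpi C g.
  by apply/esym/qpiP; rewrite mulKg.
by rewrite mulgA sec_classM //; apply/qpiP; rewrite qreprK.
Qed.

(** The defect [h] is constant on cosets: a c g = (a g) c^g, and the class of c^g is the class of c
    acted on by g, so both terms of [h] change equally. *)
Lemma theta_mulr x y : gr_quot x = 0 -> theta (x * y) = theta x *> gr_quot y.
Proof.
move=> x0; elim/gr_ind: y => [g|y z IHy IHz]; last first.
  by rewrite mulrBr !raddfB /= IHy IHz ractBr.
pose h a := theta_gen (a * g)%g - theta_gen a *> gr_gen (qpi C g).
have hE z : gr_ext h z = theta (z * gr_gen g) - theta z *> gr_gen (qpi C g).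
  elim/gr_ind: z => [a|z z' IHz IHz']; first by rewrite gr_genM /theta !gr_ext_gen.
  by rewrite mulrBl !raddfB /= IHz IHz' ractBl [in RHS]opprD addrACA -opprD.
have hC a c : c \in C -> h (a * c)%g = h a.
  move=> cC; rewrite /h.
  have -> : (a * c * g)%g = (a * g * c ^ g)%g.
    by rewrite -mulgA (conjgC c g) mulgA.
  have cgC := gpred_conj c g cC.
  rewrite (theta_genM a cC) (theta_genM _ cgC) (sec_classJ g cC) ractDl.
  by rewrite opprD addrACA subrr addr0.
by rewrite gr_quot_gen; apply: subr0_eq; rewrite -hE; exact: gr_ext_coset.
Qed.

(** Replacing a by a c adds the class of c to both terms of [h]. Consequently [theta] kills the
    product of the augmentation ideal with the kernel of [gr_quot]. *)
Lemma theta_mull g x : gr_quot x = 0 -> theta (gr_gen g * x) = theta x.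
Proof.
move=> x0; pose h a := theta_gen (g * a)%g - theta_gen a.
have hE z : gr_ext h z = theta (gr_gen g * z) - theta z.
  elim/gr_ind: z => [a|z z' IHz IHz']; first by rewrite gr_genM /theta !gr_ext_gen.
  by rewrite mulrBr !raddfB /= IHz IHz' opprD addrACA.
have hC a c : c \in C -> h (a * c)%g = h a.
  by move=> cC; rewrite /h mulgA !(theta_genM _ cC) opprD addrACA subrr addr0.
by apply: subr0_eq; rewrite -hE; exact: gr_ext_coset.
Qed.

Lemma theta_top c : c \in C -> theta (gr_gen c - 1) = sec_class S c.
Proof.
move=> cC; rewrite raddfB /= -gr_gen1 /theta !gr_ext_gen.
by rewrite -{1}[c]mul1g theta_genM // addrC addKr.
Qed.

Lemma gr_quot_top c : c \in C -> gr_quot (gr_gen c - 1) = 0.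
Proof. by move=> /qpi_eq1 c1; rewrite raddfB /= gr_quot_gen c1 rmorph1 subrr. Qed.
End Theta.

Section SectionMorphism.
Variables (G H : groupType) (S : abelian_section G) (S' : abelian_section H).
Variable f : UMagmaMorphism.type G H.
Hypothesis f_top : forall x, x \in sec_top S -> f x \in sec_top S'.
Hypothesis f_bot : forall x, x \in sec_bot S -> f x \in sec_bot S'.

Definition sec_map (t : section_module S) : section_module S' :=
  sec_class S' (f (sec_repr t)).

Lemma sec_map_class x : x \in sec_top S -> sec_map (sec_class S x) = sec_class S' (f x).
Proof.
move=> xC; apply/sec_class_eq; rewrite ?f_top ?sec_repr_top //.
rewrite -gmulfV -gmulfM; apply/f_bot/(sec_class_eq _ xC); rewrite ?sec_repr_top //.
exact: sec_reprK.
Qed.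

Lemma sec_mapD : {morph sec_map : s t / s + t}.
Proof.
move=> s t; rewrite -(sec_reprK s) -(sec_reprK t) -sec_classM ?sec_repr_top //.
by rewrite !sec_map_class ?gpredM ?sec_repr_top // gmulfM sec_classM ?f_top ?sec_repr_top.
Qed.

Lemma sec_map_zmod : zmod_morphism sec_map.
Proof.
move=> s t; apply/eqP; rewrite eq_sym subr_eq -sec_mapD subrK //.
Qed.
HB.instance Definition _ := GRing.isZmodMorphism.Build
  (section_module S) (section_module S') sec_map sec_map_zmod.

Definition ring_map : group_ring (quotg (sec_top S)) -> group_ring (quotg (sec_top S')) :=
  gr_map (qmorph f_top).
HB.instance Definition _ := GRing.RMorphism.copy ring_map (gr_map (qmorph f_top)).

Lemma ring_map_gen g :
  ring_map (gr_gen (qpi (sec_top S) g)) = gr_gen (qpi (sec_top S') (f g)).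
Proof. by rewrite /ring_map gr_map_gen qmorphE. Qed.

Lemma ring_map_quot x : ring_map (gr_quot S x) = gr_quot S' (gr_map f x).
Proof.
elim/gr_ind: x => [g|x y IHx IHy]; last by rewrite !raddfB /= IHx IHy.
by rewrite gr_quot_gen ring_map_gen gr_map_gen gr_quot_gen.
Qed.

Lemma sec_map_act t r : sec_map (t *> r) = sec_map t *> ring_map r.
Proof.
elim/gr_ind: r => [q|r s IHr IHs]; last by rewrite ractBr !raddfB /= IHr IHs ractBr.
rewrite -(sec_reprK t) -(qreprK q) -sec_classJ ?sec_repr_top //.
rewrite !sec_map_class ?gpred_conj ?sec_repr_top // gmulfJ sec_classJ ?f_top
  ?sec_repr_top //.
by rewrite ring_map_gen.
Qed.

Lemma sec_map_sum I (e : seq I) (P : pred I) (F : I -> section_module S) :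
  sec_map (\sum_(i <- e | P i) F i) = \sum_(i <- e | P i) sec_map (F i).
Proof. exact: raddf_sum. Qed.

Lemma sec_map0 : sec_map 0 = 0.
Proof. exact: raddf0. Qed.

(** The transversals chosen in [G] and [H] are unrelated, so the two sides need not agree on all of
    Z[G]; their discrepancy is constant on cosets and vanishes on the kernel. *)
Lemma sec_map_theta x : gr_quot S x = 0 -> sec_map (theta S x) = theta S' (gr_map f x).
Proof.
move=> x0; pose h g := theta_gen S' (f g) - sec_map (theta_gen S g).
have hE z : gr_ext h z = theta S' (gr_map f z) - sec_map (theta S z).
  elim/gr_ind: z => [a|z z' IHz IHz']; first by rewrite gr_map_gen /theta !gr_ext_gen.
  by rewrite !raddfB /= IHz IHz' opprD addrACA.
have hC a c : c \in sec_top S -> h (a * c)%g = h a.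
  move=> cC; rewrite /h gmulfM (theta_genM _ cC) (theta_genM _ (f_top cC)) raddfD /=
    sec_map_class //.
  by rewrite opprD addrACA subrr addr0.
by apply/esym/subr0_eq; rewrite -hE; exact: gr_ext_coset x0.
Qed.
End SectionMorphism.

(** * Ranks *)

Section Freeness.
Variables (R : nzRingType) (T : lmodType R^c).

(** Indexed families are used instead of sets because dimension counting needs an explicit number of
    unknowns; the lemmas below translate to [lin_indep] and [has_rank]. *)
Definition free_family (k : nat) (t : 'I_k -> T) : Prop :=
  forall c : 'I_k -> R, \sum_j t j *> c j = 0 -> forall j, c j = 0.

Lemma free_family_inj k (t : 'I_k -> T) : free_family t -> injective t.
Proof.
move=> freet i j tij; apply/eqP; apply: contraT => ij.
(* Equal members would give the relation with coefficients 1 at [i] and -1 at [j]. *)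
have /freet/(_ i) : \sum_l t l *> ((l == i)%:R - (l == j)%:R) = 0.
  rewrite (bigD1 i) //= (bigD1 j) 1?eq_sym //= big1 => [|l /andP[li lj]]; last first.
    by rewrite (negPf li) (negPf lj) subrr ract0r.
  rewrite eqxx eqxx eq_sym (negPf ij) subr0 sub0r addr0 ract1 tij.
  by rewrite -[X in X + _](ract1 (t j)) -ractDr subrr ract0r.
by rewrite eqxx (negPf ij) subr0 => /eqP; rewrite oner_eq0.
Qed.

Lemma free_family_lin_indep k (t : 'I_k -> T) :
  free_family t -> lin_indep (range t).
Proof.
move=> freet s c us st sum0 x xs; have tinj := free_family_inj freet.
pose c' j := if t j \in s then c (t j) else 0.
have [j _ tjx] := st x xs.
suff /freet/(_ j) : \sum_j t j *> c' j = 0 by rewrite /c' tjx xs.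
transitivity (\sum_(x <- [seq t j | j <- enum 'I_k & t j \in s]) x *> c x).
  rewrite big_map big_filter big_enum_cond /= [RHS]big_mkcond; apply: eq_bigr => l _.
  by rewrite /c'; case: ifP => // _; rewrite ract0r.
rewrite -[RHS]sum0; apply: perm_big; apply: uniq_perm => //.
  by rewrite map_inj_uniq //; apply: filter_uniq; exact: enum_uniq.
move=> y; apply/mapP/idP => [[l]|ys]; first by rewrite mem_filter => /andP[? _] ->.
have [l _ tly] := st y ys; exists l => //.
by rewrite mem_filter tly mem_enum ys.
Qed.

Lemma lin_indep_free_family k (t : 'I_k -> T) (B : set T) :
  injective t -> (forall j, B (t j)) -> lin_indep B -> free_family t.
Proof.
move=> tinj tB indB c sum0 j.
pose c' x := if [pick j | t j == x] is Some l then c l else 0.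
have c't l : c' (t l) = c l.
  by rewrite /c'; case: pickP => [i /eqP/tinj->//|/(_ l)]; rewrite eqxx.
rewrite -c't; apply: (indB [seq t j | j : 'I_k] c'); last exact: map_f (mem_enum _ _).
- by rewrite map_inj_uniq ?enum_uniq.
- by move=> x /= /mapP[l _ ->].
by rewrite big_map big_enum /= -[RHS]sum0; apply: eq_bigr => l _; rewrite c't.
Qed.

Lemma exists_max_free_family K :
    (forall k (t : 'I_k -> T), free_family t -> (k <= K)%N) ->
  exists k, exists t : 'I_k -> T, free_family t /\
    forall l (s : 'I_l -> T), free_family s -> (l <= k)%N.
Proof.
move=> leK; pose P k := `[< exists t : 'I_k -> T, free_family t >].
have P0 : exists k, P k by exists 0%N; apply/asboolP; exists (fun=> 0) => c _ [].
have PK k : P k -> (k <= K)%N by move=> /asboolP[t]; apply: leK.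
case: (ex_maxnP P0 PK) => k /asboolP[t tfree] kmax.
by exists k, t; split=> // l s sfree; apply: kmax; apply/asboolP; exists s.
Qed.

Section Maximal.
Variables (k : nat) (t : 'I_k -> T).
Hypothesis tfree : free_family t.
Hypothesis tmax : forall l (s : 'I_l -> T), free_family s -> (l <= k)%N.

Let cons_family (x : T) (j : 'I_k.+1) := if unlift ord0 j is Some i then t i else x.

Let cons_sum x (c : 'I_k.+1 -> R) : \sum_j cons_family x j *> c j =
  x *> c ord0 + \sum_j t j *> c (lift ord0 j).
Proof.
rewrite big_ord_recl /cons_family unlift_none; congr (_ + _).
by apply: eq_bigr => j _; rewrite liftK.
Qed.

(** Adjoining [x] gives a dependent family, and the coefficient of [x] in a relation is nonzero
    because [t] alone is free. *)
Lemma max_free_family_dep x : exists a (b : 'I_k -> R), a != 0 /\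
  x *> a = \sum_j t j *> b j.
Proof.
have /existsNP[c /not_implyP[]] : ~ free_family (cons_family x).
  by move=> /tmax; rewrite ltnn.
rewrite cons_sum => sum0 /existsNP[j cj0].
exists (c ord0), (fun j => - c (lift ord0 j)); split; last first.
  apply/eqP; rewrite -subr_eq0 -[X in _ == X]sum0 -sumrN; apply/eqP; congr (_ + _).
  by apply: eq_bigr => l _; rewrite /ract scaleNr opprK.
apply/eqP => c0; rewrite c0 ract0r add0r in sum0.
have [i ji|j0] := unliftP ord0 j; last by rewrite j0 c0 in cj0.
by case: cj0; rewrite ji; apply: (tfree sum0).
Qed.

(** Maximality in length implies maximality under inclusion: a strictly larger independent set would
    contain a free family of length [k.+1]. *)
Lemma max_free_family_has_rank : has_rank T k.
Proof.
exists (range t); last first.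
  apply: card_eq_trans (inj_card_eq _) _ => [i j _ _|]; first exact: free_family_inj.
  by rewrite card_eq_sym; apply: card_II.
split; first exact: free_family_lin_indep.
move=> B indB tB; apply/seteqP; split=> // x Bx; apply: contrapT => xt.
suff /tmax : free_family (cons_family x) by rewrite ltnn.
apply: (@lin_indep_free_family _ _ B) => // [i j|j].
  rewrite /cons_family; case: unliftP => [i' ->|->]; case: unliftP => [j' ->|->] //.
  - by move=> /(free_family_inj tfree)->.
  - by move=> tx; case: xt; exists i'.
  - by move=> tx; case: xt; exists j'.
by rewrite /cons_family; case: unliftP => [i _|_] //; apply: tB; exists i.
Qed.
End Maximal.
End Freeness.

(** * Common right multiples in group rings *)

Lemma subrACA (V : zmodType) (a b c d : V) : a - b - (c - d) = a - c - (b - d).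
Proof. by rewrite !opprB addrACA [RHS]addrACA [- b - c]addrC. Qed.

Definition gr_domain (Q : groupType) : Prop :=
  forall r s : group_ring Q, r * s = 0 -> r = 0 \/ s = 0.

(** This is one equation p u - q v = 0 in two unknowns; without zero divisors, neither part of a
    nonzero solution can vanish. *)
Lemma gr_ore (Q : groupType) (p q : group_ring Q) : folner Q -> gr_domain Q ->
  p != 0 -> q != 0 -> exists u v, [/\ u != 0, v != 0 & p * u = q * v].
Proof.
move=> folQ domQ p0 q0.
have [|c [b cb] /(_ tt) sum0] := @gr_system_solvable Q unit bool
  (fun _ b => if b then p else - q) folQ; first by rewrite card_unit card_bool.
have pq : p * c true = q * c false.
  by apply/eqP; rewrite -subr_eq0 -mulNr -sum0 big_bool.
have c0 : (c true == 0) = (c false == 0).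
  apply/eqP/eqP => c0; move: pq; rewrite c0 mulr0.
    by move=> /esym/domQ[/eqP|//]; rewrite (negPf q0).
  by move=> /domQ[/eqP|//]; rewrite (negPf p0).
by exists (c true), (c false); case: b cb => [|] cb; split=> //; rewrite ?c0 // -c0.
Qed.

(** * Upper bound for the rank from a generating set *)

Section RankBound.
Variables (G : groupType) (S : abelian_section G).
Local Notation C := (sec_top S).
Local Notation R := (group_ring (quotg C)).
Local Notation T := (section_module S).
Hypothesis folR : folner (quotg C).
Hypothesis domR : gr_domain (quotg C).
Variables (m r : nat) (x : 'I_m -> G) (y : G) (b : 'I_r -> T).

Definition aug (g : G) : group_ring G := gr_gen g - 1.

Lemma aug1 : aug 1%g = 0.
Proof. by rewrite /aug gr_gen1 subrr. Qed.

Lemma augM g h : aug (g * h)%g = aug g * gr_gen h + aug h.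
Proof. by rewrite /aug mulrBl gr_genM mul1r addrA subrK. Qed.

Lemma augV g : aug g^-1 * gr_gen g = - aug g.
Proof. by rewrite /aug mulrBl gr_genM mulVg gr_gen1 mul1r opprB. Qed.

Lemma theta_aug g k : gr_quot S k = 0 -> theta S (aug g * k) = 0.
Proof. by move=> k0; rewrite mulrBl mul1r raddfB /= (theta_mull _ k0) subrr. Qed.

Lemma gr_quot_aug g k : gr_quot S k = 0 -> gr_quot S (aug g * k) = 0.
Proof. by move=> k0; rewrite rmorphM /= k0 mulr0. Qed.

Lemma gr_quot_aug_eq0 g : gr_quot S (aug g) = 0 -> g \in C.
Proof.
by rewrite /aug raddfB /= gr_quot_gen rmorph1 => /subr0_eq;
  rewrite -gr_gen1 => /gr_gen_inj/qpi_eq1.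
Qed.

(* Membership of [z] in the submodule generated by the [x l - 1], [y - 1] and
   the [b s] of the augmentation ideal modulo its product with the kernel of
   [gr_quot]. *)
Definition spanned (z : group_ring G) : Prop :=
  exists (a : 'I_m -> group_ring G) (c : group_ring G) (e : 'I_r -> R),
    let w := z - \sum_l aug (x l) * a l - aug y * c in
    gr_quot S w = 0 /\ theta S w = \sum_s b s *> e s.

Lemma spannedB z z' : spanned z -> spanned z' -> spanned (z - z').
Proof.
move=> [a [c [e [w0 we]]]] [a' [c' [e' [w0' we']]]].
exists (fun l => a l - a' l), (c - c'), (fun s => e s - e' s).
rewrite (eq_bigr _ (fun l _ => mulrBr _ _ _)) sumrB mulrBr /=.
rewrite (subrACA z z') (subrACA (z - _)) [gr_quot _ _]raddfB [theta _ _]raddfB /= w0 w0'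
  subrr we we' -sumrB.
split; first by [].
by apply: eq_bigr => s _; rewrite ractBr.
Qed.

Lemma spanned_mulr z u : spanned z -> spanned (z * u).
Proof.
move=> [a [c [e [w0 we]]]].
exists (fun l => a l * u), (c * u), (fun s => e s * gr_quot S u) => /=.
rewrite (eq_bigr _ (fun l _ => mulrA _ _ _)) -mulr_suml mulrA -!mulrBl.
rewrite rmorphM /= w0 mul0r (theta_mulr _ w0) we ract_suml.
split; first by [].
by apply: eq_bigr => s _; rewrite ractA.
Qed.

Lemma spanned_ker g k : gr_quot S k = 0 -> spanned (aug g * k).
Proof.
move=> k0; exists (fun=> 0), 0, (fun=> 0) => /=.
rewrite mulr0 subr0 big1 => [|l _]; last by rewrite mulr0.
rewrite subr0 (gr_quot_aug _ k0) (theta_aug _ k0) big1; first by [].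
by move=> s _; exact: ract0r.
Qed.

Lemma spannedN z : spanned z -> spanned (- z).
Proof.
move=> sz; rewrite -sub0r; apply: spannedB => //.
by rewrite -[0](mulr0 (aug 1%g)); apply: spanned_ker; rewrite raddf0.
Qed.

Lemma spannedD z z' : spanned z -> spanned z' -> spanned (z + z').
Proof. by move=> sz /spannedN; rewrite -{2}[z']opprK; apply: spannedB. Qed.

Lemma spanned_gen l : spanned (aug (x l)).
Proof.
exists (fun j => (j == l)%:R), 0, (fun=> 0) => /=.
rewrite mulr0 subr0 (bigD1 l) //= eqxx mulr1 big1 => [|j /negPf->]; last by rewrite mulr0.
rewrite addr0 subrr !raddf0; split; first by [].
by rewrite big1; last by move=> s _; rewrite ract0r.
Qed.

(** Torsion modulo the spanned submodule. The multiplier must be nonzero in Z[G/C], the ring over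
    which ranks are counted. *)
Definition spanned_up (g : G) : Prop :=
  exists2 a, gr_quot S a != 0 & spanned (aug g * a).

Lemma spanned_up1 : spanned_up 1%g.
Proof.
exists 1; first by rewrite rmorph1 oner_eq0.
by rewrite aug1 mul0r -[0](mulr0 (aug 1%g)); apply: spanned_ker; rewrite raddf0.
Qed.

Lemma spanned_upV g : spanned_up g -> spanned_up g^-1%g.
Proof.
move=> [a a0 sa]; exists (gr_gen g * a).
  apply: contraNneq a0 => ga0; rewrite -[a]mul1r -(gr_gen1 G) -(mulVg g) -gr_genM -mulrA.
  by rewrite rmorphM /= ga0 mulr0.
by rewrite mulrA augV mulNr; apply: spannedN.
Qed.

(** From gh - 1 = (g - 1) h + (h - 1): the Ore condition yields u, v with h a' u = a v modulo the
    kernel, so multiplying by a' u leaves two spanned terms and an element of the form [aug g * k]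
    with [k] in the kernel. *)
Lemma spanned_upM g h : spanned_up g -> spanned_up h -> spanned_up (g * h)%g.
Proof.
move=> [a a0 sa] [a' a0' sa'].
have ha0' : gr_quot S (gr_gen h * a') != 0.
  apply: contraNneq a0' => ga0; rewrite -[a']mul1r -(gr_gen1 G) -(mulVg h) -gr_genM -mulrA.
  by rewrite rmorphM /= ga0 mulr0.
have [u' [v' [u0 v0]]] := gr_ore folR domR ha0' a0.
have [u uE] := gr_quot_surj u'; have [v vE] := gr_quot_surj v'.
rewrite -{u'}uE -{v'}vE in u0 v0 * => uv; exists (a' * u).
  by rewrite rmorphM; apply/eqP => /domR[] /eqP; apply/negP.
pose k := gr_gen h * (a' * u) - a * v.
have k0 : gr_quot S k = 0 by rewrite raddfB /= mulrA rmorphM /= [X in _ - X]rmorphM /= uv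
  subrr.
have -> : aug (g * h)%g * (a' * u) = aug g * k + aug g * a * v + aug h * a' * u.
  by rewrite augM mulrDl -!mulrA -mulrDr subrK.
exact: spannedD (spannedD (spanned_ker g k0) (spanned_mulr v sa)) (spanned_mulr u sa').
Qed.

Lemma spanned_up_gen l : spanned_up (x l).
Proof.
exists 1; first by rewrite rmorph1 oner_eq0.
by rewrite mulr1; apply: spanned_gen.
Qed.

(** Packaging the property as a subgroup reduces its verification to generators. *)
Lemma spanned_up_group :
  exists H : groupClosed G, forall g, g \in H <-> spanned_up g.
Proof.
pose P : {pred G} := fun g => `[< spanned_up g >].
have P1 : 1%g \in P by apply/asboolP; apply: spanned_up1.
have PM : mulg_closed P.
  by move=> u v /asboolP uP /asboolP vP; apply/asboolP/spanned_upM.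
have PV : invg_closed P by move=> u /asboolP uP; apply/asboolP/spanned_upV.
exists (HB.pack_for (groupClosed G) P
  (isMul1Closed.Build G P P1) (isMulClosed.Build G P PM) (isInvClosed.Build G P PV)).
by move=> g; split=> /asboolP.
Qed.

Hypothesis y_triv : y = 1%g \/ qpi C y <> 1%g.

(** For k > m + r, a nonzero combination of the [k] spanned elements can be chosen whose
    coefficients at the [x l] and the [b s] vanish over the quotient ring. The [y]-term then dies by
    itself, and applying [theta] gives a relation among the [t j]. *)
Lemma free_family_bound k (t : 'I_k -> T) :
  (forall g, spanned_up g) -> free_family t -> (k <= m + r)%N.
Proof.
move=> span_all tfree; rewrite leqNgt; apply/negP => lt_k.
pose g j := sec_repr (t j).
have /choice[al alP] : forall j, exists a, gr_quot S a != 0 /\ spanned (aug (g j) * a).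
  by move=> j; have [a ? ?] := span_all (g j); exists a.
have /choice[p pP] : forall j,
    exists p : ('I_m -> group_ring G) * group_ring G * ('I_r -> R),
    let w := aug (g j) * al j - \sum_l aug (x l) * p.1.1 l - aug y * p.1.2 in
    gr_quot S w = 0 /\ theta S w = \sum_s b s *> p.2 s.
  by move=> j; have [a [c [e ace]]] := (alP j).2; exists (a, c, e).
pose a j := (p j).1.1; pose c j := (p j).1.2; pose e j := (p j).2.
pose w j := aug (g j) * al j - \sum_l aug (x l) * a j l - aug y * c j.
have w0 j : gr_quot S (w j) = 0 := (pP j).1.
have we j : theta S (w j) = \sum_s b s *> e j s := (pP j).2.
(* The coefficients [c j] of [aug y] are left out of the system, which keeps the bound at m + r. *)
pose M (i : 'I_m + 'I_r) j := match i with inl l => gr_quot S (a j l) | inr s => e j s end.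
have [|f' [j0 fj0] fM] := @gr_system_solvable _ _ 'I_k M folR.
  by rewrite card_sum !card_ord.
have /choice[f fE] : forall j, exists u, gr_quot S u = f' j by move=> j;
  apply: gr_quot_surj.
pose W := \sum_j w j * f j; pose cf := \sum_j c j * f j.
have W0 : gr_quot S W = 0.
  by rewrite raddf_sum /= big1 // => j _; rewrite rmorphM /= w0 mul0r.
have thetaW : theta S W = 0.
  rewrite raddf_sum /=; under eq_bigr => j _ do
    (rewrite (theta_mulr _ (w0 j)) we ract_suml fE); rewrite exchange_big big1 /=;
      first by [].
  move=> s _.
  under eq_bigr => j _ do rewrite ractA; rewrite -ract_sumr.
  by rewrite (fM (inr s)) ract0r.
pose af l := \sum_j a j l * f j.
have af0 l : gr_quot S (af l) = 0.
  by rewrite raddf_sum /= -[RHS](fM (inl l)); apply: eq_bigr => j _; rewrite rmorphM /= fE.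
have WE : W = \sum_j aug (g j) * (al j * f j) - \sum_l aug (x l) * af l - aug y * cf.
  have wE j : w j * f j = aug (g j) * (al j * f j)
      - \sum_l aug (x l) * (a j l * f j) - aug y * (c j * f j).
    have distr (u u' s v v' z : group_ring G) :
      (u * u' - s - v * v') * z = u * (u' * z) - s * z - v * (v' * z).
      by rewrite !mulrBl !mulrA.
    rewrite /w distr mulr_suml.
    by rewrite (eq_bigr (fun l => aug (x l) * (a j l * f j))) // => l _; rewrite mulrA.
  have -> : \sum_l aug (x l) * af l = \sum_j \sum_l aug (x l) * (a j l * f j).
    by rewrite exchange_big; apply: eq_bigr => l _; exact: mulr_sumr.
  have -> : aug y * cf = \sum_j aug y * (c j * f j) by exact: mulr_sumr.
  by rewrite -sumrB -sumrB; apply: eq_bigr => j _; exact: wE.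
have gC j : g j \in C by apply: sec_repr_top.
have g0 j : gr_quot S (aug (g j)) = 0 by apply: gr_quot_top.
have sum_g0 : gr_quot S (\sum_j aug (g j) * (al j * f j)) = 0.
  by rewrite raddf_sum /= big1 // => j _; rewrite rmorphM /= g0 mul0r.
have sum_x0 : gr_quot S (\sum_l aug (x l) * af l) = 0.
  by rewrite raddf_sum /= big1 // => l _; apply: gr_quot_aug.
have ycf0 : gr_quot S (aug y) * gr_quot S cf = 0.
  by rewrite -rmorphM -[RHS]oppr0 -W0 WE !raddfB /= sum_g0 sum_x0 subrr sub0r opprK.
(* Either [aug y] is zero, or its image in the domain is nonzero, which puts [cf] in the kernel. *)
have theta_ycf : theta S (aug y * cf) = 0.
  case: y_triv => [->|y1]; first by rewrite aug1 mul0r raddf0.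
  by case: (domR ycf0) => [/gr_quot_aug_eq0/qpi_eq1/y1|/theta_aug->].
have theta_x : theta S (\sum_l aug (x l) * af l) = 0.
  by rewrite raddf_sum /=; apply: big1 => l _; exact: (theta_aug _ (af0 l)).
have /tfree/(_ j0) /domR[|] : \sum_j t j *> (gr_quot S (al j) * f' j) = 0.
- transitivity (theta S W); last exact: thetaW.
  rewrite WE [theta S _]raddfB /= theta_ycf subr0 [theta S _]raddfB /= theta_x subr0.
  rewrite raddf_sum /=.
  apply: eq_bigr => j _.
  have theta_g : theta S (aug (g j)) = t j.
    exact: (etrans (theta_top (gC j)) (sec_reprK (t j))).
  by rewrite (theta_mulr _ (g0 j)) theta_g rmorphM /= fE.
- by apply/eqP/(alP j0).1.
- by move/eqP; apply/negP.
Qed.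
End RankBound.

(** * Abelian and principal series *)

Section Derived.
Variable G : groupType.

Lemma generated_sub (X : set G) (H : groupClosed G) :
  (forall y, X y -> y \in H) -> forall x, generated X x -> x \in H.
Proof. by move=> XH x; apply. Qed.

Lemma derived1 k : derived G k 1%g.
Proof. by case: k => [//|k] /= H _; apply: gpred1. Qed.

Lemma derived_morph (H : groupType) (f : UMagmaMorphism.type G H) k x :
  derived G k x -> derived H k (f x).
Proof.
elim: k x => [//|k IH] x /= gx K KP.
pose P : {pred G} := fun x => f x \in K.
have P1 : 1%g \in P by rewrite /P [_ \in _]/= unfold_in gmulf1 gpred1.
have PM : mulg_closed P by move=> u v uP vP; rewrite unfold_in /P gmulfM gpredM.
have PV : invg_closed P by move=> u uP; rewrite unfold_in /P gmulfV gpredV.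
pose PG : groupClosed G := HB.pack_for (groupClosed G) P
  (isMul1Closed.Build G P P1) (isMulClosed.Build G P PM) (isInvClosed.Build G P PV).
apply: (gx PG) => _ [u uk [v vk <-]]; rewrite unfold_in /= /P gmulfR.
by apply: KP; exists (f u); [apply: IH | exists (f v); [apply: IH|]].
Qed.
End Derived.

Section Series.
Variables (n : nat) (G : groupType) (s : abelian_series G n).

(** A lead of [d] steps of the derived series over [s] persists, since taking commutators advances
    both by one. *)
Lemma derived_term_shift d i : (forall x, derived G i x -> x \in term s (i + d)) ->
  forall j, (i + j + d <= n)%N -> forall x, derived G (i + j) x -> x \in term s (i + j + d).
Proof.
move=> di; elim=> [|j IH] lt_n; first by rewrite addn0.
rewrite addnS addSn in lt_n *; move=> x /= gx; apply: gx => _ [u uk [v vk <-]].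
by apply: (@term_comm _ _ s (Ordinal lt_n)); apply: IH => //; apply: ltnW.
Qed.

Lemma derived_term i x : (i <= n)%N -> derived G i x -> x \in term s i.
Proof.
move=> lein gx; have := @derived_term_shift 0 0 _ i; rewrite !add0n !addn0.
by apply=> // y _; apply: term_first.
Qed.

(** Otherwise the derived series would lead by one step from [i] on and reach 1 at n - 1. *)
Lemma solvability_class_witness i : solvability_class G n -> (i < n)%N ->
  exists2 u, derived G i u & u \notin term s i.+1.
Proof.
case=> _ der_neq lt_in; apply: contrapT => no_u.
have di x : derived G i x -> x \in term s (i + 1).
  by move=> ix; rewrite addn1; apply: contrapT => /negP xi; apply: no_u; exists x.
case: (der_neq n.-1); first by rewrite prednK // (leq_ltn_trans _ lt_in).
apply/seteqP; split=> [x|_ ->]; last exact: derived1.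
move=> dx; apply: (term_last (a := s)).
have := @derived_term_shift 1 i di (n.-1 - i)%N.
have -> : (i + (n.-1 - i) = n.-1)%N by lia.
have -> : (n.-1 + 1 = n)%N by lia.
by apply.
Qed.

(** Each quotient by the next term extends the previous quotient by an abelian kernel. *)
Lemma folner_series i : (i <= n)%N -> folner (quotg (term s i)).
Proof.
elim: i => [_|i IH lt_in].
  apply: folner_trivial => q; rewrite -(qreprK q); apply/qpi_eq1; exact: term_first.
have sub := @term_sub _ _ s (Ordinal lt_in).
pose p := qmorph (f := idfun : UMagmaMorphism.type G G) sub.
apply: (folner_extension (p := p)); last exact: IH (ltnW lt_in).
  by move=> q; exists (qpi _ (repr q)); rewrite qmorphE qreprK.
move=> u v; rewrite -(qreprK u) -(qreprK v) !qmorphE.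
move=> /qpi_eq1 ui /qpi_eq1 vi; rewrite /commute -!gmulfM; apply/esym/qpiP.
have := @term_comm _ _ s (Ordinal lt_in) _ _ ui vi.
by rewrite commgEl conjgE invgM !mulgA.
Qed.

Hypothesis prin : principal_series s.

(** For a nonzero class [t], t r r' = 0 forces t r = 0 or r' = 0, and t r = 0 forces r = 0. *)
Lemma principal_domain (i : 'I_n) : gr_domain (quotg (term s i)).
Proof.
move=> r r' rr'; have [[u ui ui1] tf] := prin i.
pose S := series_section s i; pose t := sec_class S u.
have t0 : t <> 0 by move=> /(sec_class_eq0 (S := S) ui); apply/negP.
have : t *> r = 0 \/ r' = 0 by apply: (tf (t *> r)); rewrite -/(_ *> _) ractA rr' ract0r.
by case=> [/tf[/t0[]|]|]; [left|right].
Qed.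

(* [u^-1 u^x] is [u (x - 1)] in the module, so absence of torsion makes any [u]
   of this factor detect membership in [term s i]. *)
Lemma principal_commutator (i : 'I_n) u x : u \in term s i -> u \notin term s i.+1 ->
  (x \in term s i) = ([~ u, x]%g \in term s i.+1).
Proof.
move=> ui ui1; have [_ tf] := prin i.
pose S := series_section s i; pose t := sec_class S u.
have t0 : t <> 0 by move=> /(sec_class_eq0 (S := S) ui); apply/negP.
have commi : [~ u, x]%g \in term s i by rewrite commgEl gpredM ?gpredV ?gpred_conj.
have cE : sec_class S [~ u, x]%g = t *> (gr_gen (qpi (term s i) x) - 1).
  have uiV : u^-1%g \in term s i by rewrite gpredV.
  apply: (addrI t); rewrite ractBr ract1 addrCA subrr addr0 -(sec_classJ (S := S) x ui).
  by rewrite /t -(sec_classM (S := S) ui commi) commgEl mulVKg.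
apply/idP/idP => [xi|/(sec_class_eq0 (S := S) commi)].
  apply/(sec_class_eq0 (S := S) commi); rewrite cE (qpi_eq1 _ _).2 //.
  by rewrite gr_gen1 subrr ract0r.
by rewrite cE => /tf[//|] /subr0_eq; rewrite -gr_gen1 => /gr_gen_inj/qpi_eq1.
Qed.
End Series.

(** * Coordinate groups *)

Lemma pgroup_ind (P : presentation) (Q : pgroup P -> Prop) :
    Q 1%g -> (forall l x, Q x -> Q (pg_gen l * x)%g) -> forall x, Q x.
Proof.
move=> Q1 QM; elim/quotW; elim=> [|l u IH]; first exact: Q1.
have -> : \pi_(pgroup P) (l :: u) = (pg_gen l * \pi_(pgroup P) u)%g.
  by rewrite [RHS]pg_mulE.
exact: QM.
Qed.

Lemma free_gen_inv (X : choiceType) (j : X) :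
  pg_gen ((j, false) : letter (free_presentation X)) = (free_gen j)^-1%g.
Proof.
apply: (mulgI (free_gen j)); rewrite mulgV [LHS]pg_mulE.
by apply/weqP; exact: (WordRel [::] [::] (FreeCancel j true)).
Qed.

Lemma free_product_inr_monoid (A B : groupType) :
  monoid.monoid_morphism (@free_product_inr A B).
Proof.
have rel u v : product_relation u v ->
    \pi_(pgroup (product_presentation A B)) u = \pi_(pgroup (product_presentation A B)) v.
  by move=> uv; apply/weqP; have := WordRel [::] [::] uv; rewrite !cats0.
split=> [|b b']; first by apply: rel; constructor.
rewrite [RHS]pg_mulE /free_product_inr /pg_gen; apply/esym/rel.
exact: ProductMul2.
Qed.
HB.instance Definition _ (A B : groupType) := isUMagmaMorphism.Build
  B (free_product A B) (@free_product_inr A B) (@free_product_inr_monoid A B).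

Section CoordinateGroup.
Variables (A : groupType) (m : nat) (S : set (affine A m)).
Local Notation Gam := (coordinate_group S).

Definition coord_pi (f : gpoly A m) : Gam := qpi (vanishing_subgroup S) f.
HB.instance Definition _ := UMagmaMorphism.copy coord_pi (qpi (vanishing_subgroup S)).

Definition coord_repr (g : Gam) : gpoly A m :=
  repr (g : quotg (vanishing_subgroup S)).

Lemma coord_reprK g : coord_pi (coord_repr g) = g.
Proof. exact: qreprK. Qed.

Lemma coord_eqP f g :
  (coord_pi f = coord_pi g) <-> (forall a, S a -> geval a f = geval a g).
Proof.
split=> [/qpiP/asboolP fg a Sa|fg].
  by have := fg a Sa; rewrite gevalM gevalV => e1; apply: (mulgI (geval a f)^-1%g);
    rewrite e1 mulVg.
by apply/qpiP/asboolP => a Sa; rewrite gevalM gevalV fg // mulVg.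
Qed.

Section Evaluation.
Variables (a : affine A m).
Hypothesis Sa : S a.

Definition coord_eval_fun (g : Gam) : A := geval a (coord_repr g).

Lemma coord_eval_fun_pi f : coord_eval_fun (coord_pi f) = geval a f.
Proof. by have /coord_eqP := coord_reprK (coord_pi f); apply. Qed.

Lemma coord_eval_monoid : monoid.monoid_morphism coord_eval_fun.
Proof.
split=> [|g h]; first by have := coord_eval_fun_pi 1%g; rewrite gmulf1 geval1.
by rewrite -(coord_reprK g) -(coord_reprK h) -gmulfM !coord_eval_fun_pi gevalM.
Qed.

Definition coord_eval : UMagmaMorphism.type Gam A :=
  HB.pack coord_eval_fun (isUMagmaMorphism.Build Gam A coord_eval_fun coord_eval_monoid).

Lemma coord_eval_pi f : coord_eval (coord_pi f) = geval a f.
Proof. exact: coord_eval_fun_pi. Qed.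
End Evaluation.

Lemma coord_eval_eq g h :
  (forall a (Sa : S a), coord_eval Sa g = coord_eval Sa h) -> g = h.
Proof.
move=> gh; rewrite -(coord_reprK g) -(coord_reprK h); apply/coord_eqP => a Sa.
by have := gh a Sa; rewrite -{1}(coord_reprK g) -{1}(coord_reprK h) !coord_eval_pi.
Qed.

Definition coord_const (c : A) : Gam := coord_pi (gconst m c).
Definition coord_var (j : 'I_m) : Gam := coord_pi (gvar A j).

Lemma coord_eval_const a (Sa : S a) c : coord_eval Sa (coord_const c) = c.
Proof. by rewrite coord_eval_pi geval_const. Qed.

Lemma coord_const_monoid : monoid.monoid_morphism coord_const.
Proof.
by split=> [|c d]; apply: coord_eval_eq => a Sa;
  rewrite ?gmulfM ?gmulf1 !coord_eval_const.
Qed.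
HB.instance Definition _ := isUMagmaMorphism.Build A Gam coord_const coord_const_monoid.

Lemma coord_group_generated (H : groupClosed Gam) :
  (forall c, coord_const c \in H) -> (forall j, coord_var j \in H) -> forall g, g \in H.
Proof.
move=> Hc Hv g; rewrite -(coord_reprK g); move: (coord_repr g) => f.
have Hinr (w : free_group 'I_m) : coord_pi (free_product_inr A w) \in H.
  elim/pgroup_ind: w => [|[j b] w IH]; first by rewrite !gmulf1 gpred1.
  rewrite !gmulfM gpredM //; case: b; first exact: Hv.
  by rewrite free_gen_inv !gmulfV gpredV; apply: Hv.
elim/pgroup_ind: f => [|[c|w] f IH]; first by rewrite gmulf1 gpred1.
  by rewrite gmulfM gpredM //; apply: Hc.
by rewrite gmulfM gpredM //; apply: Hinr.
Qed.

Hypothesis irr : irreducible_set S.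
Hypothesis S0 : (S !=set0)%classic.

Lemma closed_zero1 (f : gpoly A m) : closed (zero_locus [set f]%classic).
Proof. by apply: closed_algebraic_set; exists [set f]%classic. Qed.

(** By induction some point [a] works for the tail [l]. If none worked for [g :: l], then [S] would
    be the union of its closed parts where [g] is trivial and where some member of [l] is; the first
    is proper because [g] is not 1, the second because it misses [a]. *)
Lemma coord_discriminate (l : seq Gam) :
  (forall g, g \in l -> g != 1%g) ->
  exists a (Sa : S a), forall g, g \in l -> coord_eval Sa g != 1%g.
Proof.
elim: l => [_|g l IH gl]; first by case: S0 => a Sa; exists a, Sa.
have [|a [Sa la]] := IH; first by move=> h hl; apply: gl; rewrite inE hl orbT.
apply: contrapT => none; case: irr => Scl; apply.
pose Z h := zero_locus [set coord_repr h]%classic.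
have ZE h b (Sb : S b) : Z h b <-> coord_eval Sb h = 1%g.
  rewrite -{2}(coord_reprK h) coord_eval_pi /Z /zero_locus /=.
  by split=> [|e _ ->//]; apply.
pose Zl := foldr (fun h U => Z h `|` U)%classic set0 l.
have Zl_closed : closed Zl.
  rewrite /Zl; elim: (l) => [|h l' IHl] /=; first exact: closed0.
  by apply: closedU => //; apply: closed_zero1.
have ZlE b (Sb : S b) : Zl b <-> exists2 h, h \in l & coord_eval Sb h = 1%g.
  rewrite /Zl; elim: (l) => [|h l' IHl] /=; first by split=> // -[].
  split=> [[/ZE-/(_ Sb) h1|/IHl[h' h'l h'1]]|[h']].
  - by exists h; rewrite ?mem_head.
  - by exists h'; rewrite // inE h'l orbT.
  - by rewrite inE => /predU1P[->|h'l] h'1; [left; apply/(ZE _ _ Sb)|right; apply/IHl;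
    exists h'].
exists (S `&` Z g)%classic, (S `&` Zl)%classic; split.
- by apply: closedI => //; apply: closed_zero1.
- exact: closedI.
- split; first by move=> b [].
  move=> SZ; have /negP := gl g (mem_head _ _); apply; apply/eqP/coord_eval_eq => b Sb.
  by rewrite gmulf1; apply/ZE; have [] := SZ b Sb.
- split; first by move=> b [].
  move=> /(_ a Sa)[_ /ZlE-/(_ Sa)[h hl h1]].
  by have := la h hl; rewrite h1 eqxx.
apply/seteqP; split=> [b Sb|b [[]|[]]//].
have [gb|gb] := eqVneq (coord_eval Sb g) 1%g; first by left; split=> //; apply/ZE.
right; split=> //; apply/ZlE; apply: contrapT => nol; apply: none; exists b, Sb => h.
rewrite inE => /predU1P[->//|hl]; apply: contra_notN nol => /eqP h1; by exists h.
Qed.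
End CoordinateGroup.

(** * Series of the coordinate group and evaluation at points *)

Section CoordinateSeries.
Variables (n m : nat) (A : groupType) (S : set (affine A m)).
Hypothesis irr : irreducible_set S.
Hypothesis S0 : (S !=set0)%classic.
Hypothesis solv : solvability_class A n.
Variable sA : abelian_series A n.
Hypothesis prinA : principal_series sA.
Local Notation Gam := (coordinate_group S).

Definition pointwise_mem (N : normalClosed A) : {pred Gam} :=
  fun g => `[< forall a (Sa : S a), coord_eval Sa g \in N >].

Lemma pointwise_memP (N : normalClosed A) (g : Gam) :
  reflect (forall a (Sa : S a), coord_eval Sa g \in N) (g \in pointwise_mem N).
Proof. exact: asboolP. Qed.

Lemma pointwise_mem1 (N : normalClosed A) : 1%g \in pointwise_mem N.
Proof. by apply/pointwise_memP => a Sa; rewrite gmulf1 gpred1. Qed.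
Lemma pointwise_memM (N : normalClosed A) : mulg_closed (pointwise_mem N).
Proof.
move=> g h /pointwise_memP gN /pointwise_memP hN; apply/pointwise_memP => a Sa.
by rewrite gmulfM; apply: gpredM; [apply: gN|apply: hN].
Qed.
Lemma pointwise_memV (N : normalClosed A) : invg_closed (pointwise_mem N).
Proof.
by move=> g /pointwise_memP gN; apply/pointwise_memP => a Sa; rewrite gmulfV gpredV;
  apply: gN.
Qed.
Lemma pointwise_memJ (N : normalClosed A) (g h : Gam) :
  g \in pointwise_mem N -> (g ^ h)%g \in pointwise_mem N.
Proof.
by move=> /pointwise_memP gN; apply/pointwise_memP => a Sa; rewrite gmulfJ;
  apply: gpred_conj.
Qed.

Definition pointwise_normal (N : normalClosed A) : normalClosed Gam :=
  mk_normal (@pointwise_mem1 N) (@pointwise_memM N) (@pointwise_memV N) (@pointwise_memJ N).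

Lemma pointwise_normalP (N : normalClosed A) (g : Gam) :
  reflect (forall a (Sa : S a), coord_eval Sa g \in N) (g \in pointwise_normal N).
Proof. exact: asboolP. Qed.

Definition coord_series : abelian_series Gam n.
Proof.
apply: (@AbelianSeries Gam n (fun i => pointwise_normal (term sA i))).
- by move=> g; apply/pointwise_normalP => a Sa; apply: term_first.
- move=> g /pointwise_normalP gn; apply: coord_eval_eq => a Sa.
  by rewrite gmulf1; apply: (term_last (gn a Sa)).
- move=> i g /pointwise_normalP gi; apply/pointwise_normalP => a Sa.
  exact: term_sub (gi a Sa).
move=> i g h /pointwise_normalP gi /pointwise_normalP hi; apply/pointwise_normalP => a Sa.
by rewrite gmulfR term_comm.
Defined.

Definition pointwise_series (sG : abelian_series Gam n) : Prop :=
  forall i, (i <= n)%N -> forall g,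
    g \in term sG i <-> forall a (Sa : S a), coord_eval Sa g \in term sA i.

Lemma coord_series_pointwise : pointwise_series coord_series.
Proof. by move=> i _ g; split=> [/pointwise_normalP|/pointwise_normalP]. Qed.

(** Downward induction from [n]: in both groups, membership in a term means that the commutator with
    one witness lies in the next term, and a constant can serve as witness for both. *)
Lemma principal_pointwise sG : principal_series sG -> pointwise_series sG.
Proof.
move=> prinG i lein; rewrite -(subKn lein).
elim: (n - i)%N (leq_subr i n) => [|d IH] ltdn g.
  rewrite subn0; split=> [/term_last->|gn].
    by move=> a Sa; rewrite gmulf1 gpred1.
  suff -> : g = 1%g by rewrite gpred1.
  by apply: coord_eval_eq => a Sa; rewrite gmulf1; apply: (term_last (gn a Sa)).
have lt_in : (n - d.+1 < n)%N by lia.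
have succ : (n - d.+1).+1 = (n - d)%N by lia.
have [u du un] := solvability_class_witness sA solv lt_in.
have ui : u \in term sA (n - d.+1) by apply: derived_term => //; apply: ltnW.
(* The witness comes from the derived series, whose image lies in the terms of every abelian series
   of the coordinate group. *)
have cui : coord_const S u \in term sG (n - d.+1).
  by apply: derived_term; [exact: ltnW|exact: derived_morph du].
have IH' h : h \in term sG (n - d.+1).+1 <->
    forall a (Sa : S a), coord_eval Sa h \in term sA (n - d.+1).+1.
  by rewrite succ; apply: IH; apply: ltnW.
have cun : coord_const S u \notin term sG (n - d.+1).+1.
  apply/negP => /IH' cu; case: S0 => a Sa; have := cu a Sa.
  by rewrite coord_eval_const; apply/negP.
rewrite (principal_commutator prinG (i := Ordinal lt_in) g cui cun).
split=> [/IH' gi a Sa|gi].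
  rewrite (principal_commutator prinA (i := Ordinal lt_in) _ ui un).
  by have := gi a Sa; rewrite gmulfR coord_eval_const.
apply/IH' => a Sa; rewrite gmulfR coord_eval_const.
by rewrite -(principal_commutator prinA (i := Ordinal lt_in) _ ui un).
Qed.

(* Iterated commutators with witnesses turn membership in [term sA i] into
   a single equation. *)
Lemma term_equation i : (i <= n)%N -> exists (F : A -> A) (F' : Gam -> Gam),
  (forall x, (x \in term sA i) = (F x == 1%g)) /\
  forall a (Sa : S a) g, coord_eval Sa (F' g) = F (coord_eval Sa g).
Proof.
move=> lein; rewrite -(subKn lein); elim: (n - i)%N (leq_subr i n) => [|d IH] ltdn.
  exists id, id; split=> // x; rewrite subn0.
  by apply/idP/eqP => [/term_last//|->]; rewrite gpred1.
have lt_in : (n - d.+1 < n)%N by lia.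
have succ : (n - d.+1).+1 = (n - d)%N by lia.
have [u du un] := solvability_class_witness sA solv lt_in.
have ui : u \in term sA (n - d.+1) by apply: derived_term => //; apply: ltnW.
have [F [F' [FP F'E]]] := IH (ltnW ltdn).
exists (fun x => F [~ u, x]%g), (fun g => F' [~ coord_const S u, g]%g); split=> [x|a Sa g].
  by rewrite (principal_commutator prinA (i := Ordinal lt_in) _ ui un) -FP succ.
by rewrite F'E gmulfR coord_eval_const.
Qed.

(** Each non-membership becomes the non-triviality of one element by [term_equation], and
    irreducibility treats finitely many of these at once. *)
Lemma separate_terms (l : seq (Gam * nat)) :
    (forall p, p \in l -> (p.2 <= n)%N /\
       exists a (Sa : S a), coord_eval Sa p.1 \notin term sA p.2) ->
  exists a (Sa : S a), forall p, p \in l -> coord_eval Sa p.1 \notin term sA p.2.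
Proof.
move=> lP.
have [l' l'1 l'l] : exists2 l' : seq Gam, (forall g, g \in l' -> g != 1%g) &
    forall a (Sa : S a), (forall g, g \in l' -> coord_eval Sa g != 1%g) ->
    forall p, p \in l -> coord_eval Sa p.1 \notin term sA p.2.
  elim: l lP => [|[g i] l IH] lP; first by exists [::].
  have [|l' l'1 l'l] := IH; first by move=> p pl; apply: lP; rewrite inE pl orbT.
  have [/= lein [a0 [Sa0 gi]]] := lP _ (mem_head _ _).
  have [F [F' [FP F'E]]] := term_equation lein.
  exists (F' g :: l') => [h|a Sa h1 p]; rewrite inE => /predU1P[->|].
  - apply: contraNneq gi => F'1; rewrite FP -F'E F'1 gmulf1 //.
  - exact: l'1.
  - by rewrite /= FP -F'E; apply: h1; rewrite mem_head.
  by apply: l'l => h' h'l; apply: h1; rewrite inE h'l orbT.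
have [a [Sa aP]] := coord_discriminate irr S0 l'1.
by exists a, Sa; apply: l'l.
Qed.

Section Pointwise.
Variables (sG : abelian_series Gam n).
Hypothesis pw : pointwise_series sG.
Variable i : 'I_n.
Let SG := series_section sG i.
Let SA := series_section sA i.

Lemma eval_top a (Sa : S a) g : g \in sec_top SG -> coord_eval Sa g \in sec_top SA.
Proof. by move/(pw (ltnW (ltn_ord i))). Qed.
Lemma eval_bot a (Sa : S a) g : g \in sec_bot SG -> coord_eval Sa g \in sec_bot SA.
Proof. by move/(pw (ltn_ord i)). Qed.
Lemma const_top c : c \in sec_top SA <-> coord_const S c \in sec_top SG.
Proof.
split=> [ci|/(pw (ltnW (ltn_ord i))) ci].
  by apply/(pw (ltnW (ltn_ord i))) => a Sa; rewrite coord_eval_const.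
by case: S0 => a Sa; have := ci a Sa; rewrite coord_eval_const.
Qed.
Lemma const_bot c : c \in sec_bot SA <-> coord_const S c \in sec_bot SG.
Proof.
split=> [ci|/(pw (ltn_ord i)) ci].
  by apply/(pw (ltn_ord i)) => a Sa; rewrite coord_eval_const.
by case: S0 => a Sa; have := ci a Sa; rewrite coord_eval_const.
Qed.

(** Besides [l], the quotients of support elements of [r] lying in different cosets are kept outside
    the [i]-th term. Evaluation is then injective on the support, so no terms of [r] merge. *)
Lemma separate_ring (r : group_ring (quotg (sec_top SG))) (l : seq (Gam * nat)) :
    r != 0 -> (forall p, p \in l -> (p.2 <= n)%N /\
       exists a (Sa : S a), coord_eval Sa p.1 \notin term sA p.2) ->
  exists a (Sa : S a), ring_map (@eval_top a Sa) r != 0 /\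
    forall p, p \in l -> coord_eval Sa p.1 \notin term sA p.2.
Proof.
move=> r0 lP.
pose d := [seq ((repr p)^-1 * repr q, i : nat)%g | p <- gr_supp r, q <- gr_supp r].
pose dl := [seq z <- d | z.1 \notin term sG i] ++ l.
have [z|a [Sa aP]] := separate_terms (l := dl).
  rewrite mem_cat mem_filter => /orP[/andP[zi /allpairsP[pq [_ _ zE]]]|]; last exact: lP.
  split; first by rewrite zE /=; apply: ltnW.
  rewrite zE /=; apply: contrapT => none; case/negP: zi; rewrite zE.
  apply/(pw (ltnW (ltn_ord i))) => a Sa; apply: contrapT => /negP ai.
  by apply: none; exists a, Sa.
exists a, Sa; split=> [|p pl]; last by apply: aP; rewrite mem_cat pl orbT.
apply: gr_map_neq0 => // p q ps qs; rewrite -{1}(qreprK p) -{1}(qreprK q) !qmorphE.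
move=> /qpiP; rewrite -gmulfV -gmulfM => pq.
rewrite -(qreprK p) -(qreprK q); apply/qpiP; apply: contraT => npq.
have := aP ((repr p)^-1 * repr q, i : nat)%g; rewrite /= pq; apply.
by rewrite mem_cat mem_filter /= npq /=; apply/orP; left; apply/allpairsP; exists (p, q).
Qed.

Lemma sec_map_eval_const a (Sa : S a) (t : section_module SA) :
  sec_map SA (coord_eval Sa) (sec_map SG (coord_const S) t) = t.
Proof.
rewrite -(sec_reprK t) sec_map_class; last exact: sec_repr_top.
- rewrite sec_map_class; last exact/const_top/sec_repr_top.
  + by rewrite coord_eval_const.
  + exact: eval_top.
  + exact: eval_bot.
- by move=> c /const_top.
- by move=> c /const_bot.
Qed.
End Pointwise.
End CoordinateSeries.

(** * Absence of torsion and independence via evaluation *)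

Section Pointwise.
Variables (n m : nat) (A : groupType) (S : set (affine A m)).
Hypothesis irr : irreducible_set S.
Hypothesis S0 : (S !=set0)%classic.
Hypothesis solv : solvability_class A n.
Variable sA : abelian_series A n.
Hypothesis prinA : principal_series sA.
Variables (sG : abelian_series (coordinate_group S) n).
Hypothesis pw : pointwise_series sA sG.

(** If t r = 0 with both nonzero, some point keeps both nonzero and yields torsion in the
    corresponding factor of [A]. *)
Lemma pointwise_principal : principal_series sG.
Proof.
move=> i; split=> [|t r tr0].
  have [u ui un] := (prinA i).1; exists (coord_const S u).
    exact/(const_top S0 pw).
  by apply: contraNN un => /(const_bot S0 pw).
have [->|r0] := eqVneq r 0; first by right.
left; apply: contrapT => t0; pose g := sec_repr t.
have gn : g \notin term sG i.+1.
  apply/negP => gn; apply: t0; rewrite -(sec_reprK t).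
  exact/(sec_class_eq0 (sec_repr_top t)).
have [p|a [Sa [ra ga]]] := separate_ring irr S0 solv prinA pw r0 (l := [:: (g, i.+1)]).
  rewrite inE => /eqP->; split=> //=; apply: contrapT => none; case/negP: gn.
  by apply/(pw (ltn_ord i)) => a Sa; apply: contrapT => /negP ai; apply: none; exists a, Sa.
have {}ga := ga _ (mem_head _ _).
have tf := (prinA i).2.
pose f_top := @eval_top _ _ _ _ _ _ pw i a Sa.
pose f_bot := @eval_bot _ _ _ _ _ _ pw i a Sa.
have ta0 : sec_map (series_section sA i) (coord_eval Sa) t <> 0.
  rewrite -(sec_reprK t) (sec_map_class f_top f_bot (sec_repr_top t)).
  by move=> /(sec_class_eq0 (f_top _ (sec_repr_top t))); apply/negP.
have := sec_map_act f_top f_bot t r; rewrite [t *> r]tr0 (sec_map0 f_top f_bot).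
by move=> /esym/tf[//|/eqP]; apply/negP.
Qed.

(** A relation with a nonzero coefficient is evaluated at a point where that coefficient survives;
    evaluation fixes the constants, so a nontrivial relation over [A] results. *)
Lemma const_free_family (i : 'I_n) k (t : 'I_k -> series_factor sA i) :
  free_family t ->
  free_family (fun j => sec_map (series_section sG i) (coord_const S) (t j)).
Proof.
move=> tfree c sum0 j; apply: contrapT => /eqP cj0.
have [//|a [Sa [ca _]]] := separate_ring irr S0 solv prinA pw cj0 (l := [::]).
pose f_top := @eval_top _ _ _ _ _ _ pw i a Sa.
pose f_bot := @eval_bot _ _ _ _ _ _ pw i a Sa.
suff /tfree/(_ j)/eqP : \sum_l t l *> ring_map f_top (c l) = 0 by apply/negP.
have := congr1 (sec_map (series_section sA i) (coord_eval Sa)) sum0.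
rewrite (sec_map0 f_top f_bot) (sec_map_sum f_top f_bot) => {2}<-.
apply: eq_bigr => l _; rewrite (sec_map_act f_top f_bot).
by rewrite (sec_map_eval_const S0 pw).
Qed.
End Pointwise.

(** * Solvability class and rank inequalities *)

Section RankOfCoordinateGroup.
Variables (n m : nat) (A : groupType) (S : set (affine A m)).
Hypothesis fgA : finitely_generated A.
Hypothesis irr : irreducible_set S.
Hypothesis S0 : (S !=set0)%classic.
Hypothesis solv : solvability_class A n.
Variable sA : abelian_series A n.
Hypothesis prinA : principal_series sA.

(** The lifted series bounds the class by [n]; the constants form a copy of [A], so no smaller value
    is possible. *)
Lemma coord_solvability_class : solvability_class (coordinate_group S) n.
Proof.
split=> [|k lt_kn].
  apply/seteqP; split=> [g gn|_ ->]; last exact: derived1.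
  exact/(term_last (derived_term (coord_series S sA) (leqnn n) gn)).
have [u du un] := solvability_class_witness sA solv lt_kn.
move=> dk1; have := derived_morph (coord_const S : UMagmaMorphism.type _ _) du.
rewrite dk1 => cu1; case/negP: un; case: S0 => a Sa.
by rewrite -(coord_eval_const Sa u) cu1 gmulf1 gpred1.
Qed.

Variable i : 'I_n.
Let SA := series_section sA i.
Let folA : folner (quotg (sec_top SA)) := @folner_series _ _ sA i (ltnW (ltn_ord i)).
Let domA : gr_domain (quotg (sec_top SA)) := principal_domain prinA (i := i).

(** Finite generation makes the ranks of [A] finite: the generators play the part of [x], with no
    [b] and [y] equal to 1. *)
Lemma free_family_bound_fg : exists K, forall k (t : 'I_k -> series_factor sA i),
  free_family t -> (k <= K)%N.
Proof.
case: fgA => s gens; exists (size s + 0)%N => k t.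
pose x j := tnth (in_tuple s) j; pose b (j : 'I_0) : section_module SA := 0%R.
have [H HP] := spanned_up_group folA domA x 1%g b.
apply: (@free_family_bound A SA folA domA _ _ x 1%g b); first by left.
move=> g; apply/HP; have : generated [set` s] g by rewrite gens.
apply: generated_sub => h /= /(tnthP (in_tuple s))[j ->].
exact/HP/spanned_up_gen.
Qed.


(** By the Ore condition, e - 1 and y - 1 have multiples that agree modulo the kernel, and
    maximality of [b] makes [theta] of their difference torsion modulo the span of [b]. *)
Lemma max_free_spanned_up r (b : 'I_r -> section_module SA) :
    free_family b -> (forall l (t : 'I_l -> section_module SA), free_family t -> (l <=
      r)%N) ->
  exists2 y : A, y = 1%g \/ y \notin term sA i &
    forall e, spanned_up (fun j : 'I_0 => 1%g) y b e.
Proof.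
move=> bfree bmax.
(* The choice y = 1 is made exactly when the quotient by the [i]-th term is trivial; every [e] then
   has [aug e] in the kernel. *)
have [y yi yP] : exists2 y : A, y = 1%g \/ y \notin term sA i &
    y = 1%g -> forall e, e \in term sA i.
  have [ex_y|no_y] := pselect (exists y, y \notin term sA i).
    case: ex_y => y yi; exists y; first by right.
    by move=> y1; rewrite y1 gpred1 in yi.
  exists 1%g; first by left.
  by move=> _ e; apply: contrapT => /negP ei; apply: no_y; exists e.
exists y => // e.
have [u [v [u0 uv]]] : exists u v : group_ring A,
    gr_quot SA u != 0 /\ gr_quot SA (aug e * u) = gr_quot SA (aug y * v).
  have [e0|e0] := eqVneq (gr_quot SA (aug e)) 0.
    exists 1, 0; rewrite rmorph1 oner_eq0 mulr1 mulr0 raddf0; split=> //.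
  have y0 : gr_quot SA (aug y) != 0.
    apply: contra_neq e0 => /gr_quot_aug_eq0 yi'; apply: gr_quot_top.
    by case: yi => [/yP//|]; rewrite yi'.
  have [u' [v' [u0 _]]] := gr_ore folA domA e0 y0.
  have [u uE] := gr_quot_surj u'; have [v vE] := gr_quot_surj v'.
  by exists u, v; rewrite !rmorphM /= uE vE.
pose w := aug e * u - aug y * v.
have w0 : gr_quot SA w = 0 by rewrite raddfB /= uv subrr.
have [a' [c [a0 ac]]] := max_free_family_dep bfree bmax (theta SA w).
have [a aE] := gr_quot_surj a'.
exists (u * a).
  by rewrite rmorphM /= aE; apply/eqP => /domA[] /eqP; apply/negP; [exact: u0|exact: a0].
exists (fun=> 0), (v * a), c => /=; rewrite big_ord0 subr0.
have distr (p p' q q' z : group_ring A) :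
  p * (p' * z) - q * (q' * z) = (p * p' - q * q') * z by rewrite mulrBl !mulrA.
by rewrite distr -/w rmorphM /= w0 mul0r (theta_mulr _ w0) aE ac.
Qed.

Variables (sG : abelian_series (coordinate_group S) n).
Hypothesis pw : pointwise_series sA sG.
Let SG := series_section sG i.
Let c_top c : c \in sec_top SA -> coord_const S c \in sec_top SG := (const_top S0 pw i c).1.
Let c_bot c : c \in sec_bot SA -> coord_const S c \in sec_bot SG := (const_bot S0 pw i c).1.

(** The relation is transported along the constants, with zero coefficients at the variables. The
    multiplier stays nonzero because a constant lies in the [i]-th term of [sG] only if it does so
    in [sA]. *)
Lemma spanned_up_const r (b : 'I_r -> section_module SA) y e :
    spanned_up (fun j : 'I_0 => 1%g) y b e ->
  spanned_up (@coord_var A m S) (coord_const S y)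
    (fun j => sec_map SG (coord_const S) (b j)) (coord_const S e).
Proof.
pose cm := gr_map (coord_const S).
have aug_map g : aug (coord_const S g) = cm (aug g).
  by rewrite /aug /cm raddfB /= gr_map_gen rmorph1.
move=> [a a0 [x0 [c [z [w0 wz]]]]]; exists (cm a).
  rewrite -(ring_map_quot c_top); apply: contra_neq a0 => /eqP.
  rewrite -(rmorph0 (ring_map c_top)) => /eqP/gr_map_inj; apply.
  by apply: qmorph_inj => x /(const_top S0 pw).
rewrite big_ord0 subr0 in w0 wz.
exists (fun=> 0), (cm c), (fun s => ring_map c_top (z s)) => /=.
rewrite big1 ?subr0 => [|j _]; last by rewrite mulr0.
have -> : aug (coord_const S e) * cm a - aug (coord_const S y) * cm c =
    cm (aug e * a - aug y * c) by rewrite !aug_map /cm [RHS]raddfB /= !rmorphM.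
rewrite -(ring_map_quot c_top) w0 rmorph0; split=> //.
rewrite -(sec_map_theta c_top c_bot w0) wz (sec_map_sum c_top c_bot).
by apply: eq_bigr => s _; rewrite (sec_map_act c_top c_bot).
Qed.

(** The variables supply m spanning elements and the constants r more, besides y - 1, which gives
    the upper bound; the images of [b] remain free, which gives the lower one. *)
Lemma pointwise_rank_bounds : exists rA rG,
  [/\ has_rank (series_factor sA i) rA, has_rank (series_factor sG i) rG &
      (0 <= rG%:Z - rA%:Z <= m%:Z)%R].
Proof.
have [K KA] := free_family_bound_fg.
have [r [b [bfree bmax]]] := exists_max_free_family KA.
have [y yi ye] := max_free_spanned_up bfree bmax.
have prinG := pointwise_principal irr S0 solv prinA pw.
pose b' j := sec_map SG (coord_const S) (b j).
have domG : gr_domain (quotg (sec_top SG)) := principal_domain prinG (i := i).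
have folG : folner (quotg (sec_top SG)) := @folner_series _ _ sG i (ltnW (ltn_ord i)).
have KG k (t : 'I_k -> series_factor sG i) : free_family t -> (k <= m + r)%N.
  apply: (@free_family_bound _ SG folG domG _ _ (@coord_var A m S) (coord_const S y) b').
    case: yi => [->|yi]; first by left; rewrite gmulf1.
    by right => /qpi_eq1 /(const_top S0 pw); apply/negP.
  have [H HP] := spanned_up_group folG domG (@coord_var A m S) (coord_const S y) b'.
  move=> g; apply/HP; apply: coord_group_generated => [c|j].
    exact/HP/spanned_up_const.
  exact/HP/spanned_up_gen.
have [rG [bG [bGfree bGmax]]] := exists_max_free_family KG.
exists r, rG; split; [exact: max_free_family_has_rank bfree bmax|exact:
  max_free_family_has_rank bGfree bGmax|].
have le1 : (r <= rG)%N.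
  exact: bGmax (const_free_family irr S0 solv prinA pw bfree).
by have := KG _ _ bGfree; lia.
Qed.
End RankOfCoordinateGroup.

Theorem theorem7p1 (n m : nat) (A : groupType) (S : set (affine A m)) :
  finitely_generated A ->
  n_rigid n A ->
  algebraic_set S ->
  irreducible_set S ->
  (S !=set0)%classic ->
  n_rigid n (coordinate_group S) /\
  forall (sA : abelian_series A n)
         (sG : abelian_series (coordinate_group S) n),
    principal_series sA -> principal_series sG ->
    forall i : 'I_n, exists rA rG : nat,
      [/\ has_rank (series_factor sA i) rA,
          has_rank (series_factor sG i) rG &
          (0 <= rG%:Z - rA%:Z <= m%:Z)%R].
Proof.
move=> fgA [solv [s0 prin0]] _ irr S0; split.
  split; first exact: coord_solvability_class S0 solv s0.
  exists (coord_series S s0).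
  have pw := @coord_series_pointwise _ _ _ S s0.
  exact: (pointwise_principal irr S0 solv prin0 pw).
move=> sA sG prinA prinG i.
(* Arbitrary principal series are covered because that of the coordinate group must be the pointwise
   preimage of [sA]. *)
have pw := principal_pointwise S0 solv prinA prinG.
exact: (pointwise_rank_bounds fgA irr S0 solv prinA i pw).
Qed.
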